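(* Assume (A1), (A2) and (A3) (stated in the context). Let $\lambda_{\mathrm{num}},\lambda_{\mathrm{cat}},\lambda_{\mathrm{CInd}}>0$ be fixed constants with $\lambda_{\mathrm{num}}+\lambda_{\mathrm{cat}}+\lambda_{\mathrm{CInd}}=1$, and let $(e^\ast,d^\ast)$, with $d^\ast=(d^{\mathrm{num}\,*},d^{\mathrm{cat}\,*})$, be a minimizer over all encoder--decoder pairs $(e,d)$ of $$\mathcal{L}_{\mathrm{total}}(e,d)=\lambda_{\mathrm{num}}\mathcal{L}_{\mathrm{num}}(e,d^{\mathrm{num}})+\lambda_{\mathrm{cat}}\mathcal{L}_{\mathrm{cat}}(e,d^{\mathrm{cat}})+\lambda_{\mathrm{CInd}}\mathcal{L}_{\mathrm{CInd}}(e).$$ Then: (i) (Optimal decoder) For $P^\ast$-almost every $x$, the random vector $d^{\mathrm{num}\,*}(e^\ast(x),\varepsilon)$ (with $x$ fixed and $\varepsilon$ random) is distributed according to the conditional law of $X^{\mathrm{num}}$ given $e^\ast(X)=e^\ast(x)$, and $$d^{\mathrm{cat}\,*}(\cdot\mid e^\ast(x))=P(X^{\mathrm{cat}}=\cdot\mid e^\ast(X)=e^\ast(x)).$$ (ii) (Optimal encoder) The encoder $e^\ast$ satisfies $$e^\ast\in\arg\min_e\Big\{\lambda_{\mathrm{num}}\,\tfrac12\,\mathbb{E}_{X\sim P^\ast}\,\mathbb{E}_{Y,Y'\sim P(X^{\mathrm{num}}\mid e(X))}\|Y-Y'\|_2^\beta+\lambda_{\mathrm{cat}}\,H(X^{\mathrm{cat}}\mid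 e(X))+\lambda_{\mathrm{CInd}}\,I(X^{\mathrm{num}};X^{\mathrm{cat}}\mid e(X))\Big\},$$ where the minimum is over all encoders $e$ and, given $e(X)$, the vectors $Y,Y'$ are independent draws from the conditional law of $X^{\mathrm{num}}$ given $e(X)$.
   Context: Data. $X=(X^{\mathrm{num}},X^{\mathrm{cat}})\sim P^\ast$ is a random element of $\mathcal{X}=\mathbb{R}^{d_{\mathrm{num}}}\times\mathcal{C}$, where $X^{\mathrm{num}}\in\mathbb{R}^{d_{\mathrm{num}}}$ and $X^{\mathrm{cat}}=(X^{\mathrm{cat},1},\dots,X^{\mathrm{cat},d_{\mathrm{cat}}})$ takes values in the finite set $\mathcal{C}=\prod_{j=1}^{d_{\mathrm{cat}}}\mathcal{C}_j$, $|\mathcal{C}_j|=K_j$. Fix $\beta\in(0,2)$. Encoders and decoders. An encoder (representation map) is a measurable map $e:\mathcal{X}\to\mathbb{R}^{\ell}$ ($\ell$ a fixed latent dimension); write $Z=e(X)$ and $P_Z$ for the law of $Z$. Let $\varepsilon,\varepsilon'$ be independent standard Gaussian noise vectors (of a fixed dimension), independent of $X$. A decoder is a pair $d=(d^{\mathrm{num}},d^{\mathrm{cat}})$ from a given class of admissible decoders (the numerical and categorical components can be chosen separately), where $d^{\mathrm{num}}(z,\varepsilon)\in\mathbb{R}^{d_{\mathrm{num}}}$ is measurable in $(z,\varepsilon)$ and, for each $z\in\mathbb{R}^{\ell}$, $d^{\mathrm{cat}}(\cdot\mid z)$ is a probability mass function on $\mathcal{C}$, measurable in $z$. Auxiliary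 models. $\{q_\theta(\cdot\mid z)\}_\theta$ and $\{q_\psi(\cdot\mid z,x^{\mathrm{num}})\}_\psi$ are two parametrized families of conditional probability mass functions on $\mathcal{C}$, the first given $z\in\mathbb{R}^{\ell}$, the second given $(z,x^{\mathrm{num}})\in\mathbb{R}^{\ell}\times\mathbb{R}^{d_{\mathrm{num}}}$. Losses. $$\mathcal{L}_{\mathrm{num}}(e,d^{\mathrm{num}})=\mathbb{E}_{X}\mathbb{E}_{\varepsilon}\|X^{\mathrm{num}}-d^{\mathrm{num}}(e(X),\varepsilon)\|_2^\beta-\tfrac12\,\mathbb{E}_{X}\mathbb{E}_{\varepsilon,\varepsilon'}\|d^{\mathrm{num}}(e(X),\varepsilon)-d^{\mathrm{num}}(e(X),\varepsilon')\|_2^\beta,$$ $$\mathcal{L}_{\mathrm{cat}}(e,d^{\mathrm{cat}})=\mathbb{E}_X[-\log d^{\mathrm{cat}}(X^{\mathrm{cat}}\mid e(X))],$$ $$\mathcal{L}_{\mathrm{CInd}}(e)=\inf_\theta\mathbb{E}[-\log q_\theta(X^{\mathrm{cat}}\mid e(X))]-\inf_\psi\mathbb{E}[-\log q_\psi(X^{\mathrm{cat}}\mid e(X),X^{\mathrm{num}})],$$ with $-\log 0=+\infty$. The difference defining $\mathcal{L}_{\mathrm{num}}$ is understood as $\mathbb{E}_Z$ of the difference of the two conditional expectations given $Z=e(X)$ (i.e. the expected conditional energy score). Assumptions. (A1) For every encoder $e$ there exist (admissible) decoder functions such that, for $P_Z$-almost every $z$, $d^{\mathrm{num}}(z,\varepsilon)$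 has the conditional law of $X^{\mathrm{num}}$ given $Z=z$, and $d^{\mathrm{cat}}(\cdot\mid z)=P(X^{\mathrm{cat}}=\cdot\mid Z=z)$. (A2) The classes of $q_\theta$ and $q_\psi$ are rich enough that, for every encoder $e$, some $\theta$ and some $\psi$ satisfy $q_\theta(\cdot\mid Z)=P(X^{\mathrm{cat}}=\cdot\mid Z)$ and $q_\psi(\cdot\mid Z,X^{\mathrm{num}})=P(X^{\mathrm{cat}}=\cdot\mid Z,X^{\mathrm{num}})$ for almost every input. (A3) $\mathbb{E}\|X^{\mathrm{num}}\|_2^\beta<\infty$, and for every admissible numerical decoder $d^{\mathrm{num}}$, $\mathbb{E}\|d^{\mathrm{num}}(z,\varepsilon)\|_2^\beta<\infty$ for $P_Z$-almost every $z$. Information quantities. $H(\cdot\mid\cdot)$ is conditional (Shannon) entropy: $H(X^{\mathrm{cat}}\mid W)=\mathbb{E}_W\big[-\sum_{c\in\mathcal{C}}P(X^{\mathrm{cat}}=c\mid W)\log P(X^{\mathrm{cat}}=c\mid W)\big]$. Conditional mutual information is $I(X^{\mathrm{num}};X^{\mathrm{cat}}\mid e(X))=H(X^{\mathrm{cat}}\mid e(X))-H(X^{\mathrm{cat}}\mid e(X),X^{\mathrm{num}})$. *)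

(* Defs.v *)
From HB Require Import structures.
From mathcomp Require Import all_boot all_order all_algebra.
From mathcomp Require Import all_classical all_reals all_analysis.

Set Implicit Arguments.
Unset Strict Implicit.
Unset Printing Implicit Defensive.

Import Order.TTheory GRing.Theory Num.Theory.
Import numFieldNormedType.Exports.

Local Open Scope classical_set_scope.
Local Open Scope ring_scope.

(* [measurableType] requires a distinguished point, so the category sets are
   taken to be nonempty finite types; this costs no generality, since X^cat
   takes a value in each of them. *)
#[short(type="finPointedType")]
HB.structure Definition FinPointed := {T of Pointed T & Finite T}.

Definition categories (k : nat) (C : 'I_k -> finPointedType) : Type :=
  {dffun forall j : 'I_k, C j}.

HB.instance Definition _ k (C : 'I_k -> finPointedType) :=
  Finite.on (categories C).
HB.instance Definition _ k (C : 'I_k -> finPointedType) :=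
  isPointed.Build (categories C) [ffun j => (point : C j)].
HB.instance Definition _ k (C : 'I_k -> finPointedType) :=
  @isMeasurable.Build default_measure_display (categories C)
    discrete_measurable discrete_measurable0
    discrete_measurableC discrete_measurableU.

Section EuclideanNorm.
Context {R : realType} {n : nat}.

Definition euclid_norm (x : n.-tuple R) : R :=
  Num.sqrt (\sum_(i < n) tnth x i ^+ 2).

Definition euclid_dist (x y : n.-tuple R) : R :=
  euclid_norm [tuple tnth x i - tnth y i | i < n].

End EuclideanNorm.

Section Probability.
Context {R : realType} {d : measure_display} {Omega : measurableType d}.
Variable P : probability Omega R.
Local Open Scope ereal_scope.

(* the law N(0, I_n): independent standard normal coordinates *)
Definition standard_gaussian (n : nat) (eps : Omega -> n.-tuple R) : Prop :=
  forall B : 'I_n -> set R, (forall i, measurable (B i)) ->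
    P [set w | forall i, B i (tnth (eps w) i)] =
    \prod_(i < n) normal_prob 0 1 (B i).

(* Taking some of the sets to be [setT] gives the product rule for
   subfamilies. *)
Definition independent3 (d1 d2 d3 : measure_display)
    (T1 : measurableType d1) (T2 : measurableType d2) (T3 : measurableType d3)
    (X1 : Omega -> T1) (X2 : Omega -> T2) (X3 : Omega -> T3) : Prop :=
  forall A1 A2 A3, measurable A1 -> measurable A2 -> measurable A3 ->
    P (X1 @^-1` A1 `&` X2 @^-1` A2 `&` X3 @^-1` A3) =
    P (X1 @^-1` A1) * P (X2 @^-1` A2) * P (X3 @^-1` A3).

(* K w is a (regular) version of the conditional law of V given W = w. *)
Definition conditional_law (dV dW : measure_display)
    (TV : measurableType dV) (TW : measurableType dW)
    (V : Omega -> TV) (W : Omega -> TW) (K : R.-pker TW ~> TV) : Prop :=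
  forall A B, measurable A -> measurable B ->
    P (V @^-1` A `&` W @^-1` B) = \int[P]_(w in W @^-1` B) K (W w) A.

Definition has_law (dV : measure_display) (TV : measurableType dV)
    (V : Omega -> TV) (mu : set TV -> \bar R) : Prop :=
  forall A, measurable A -> P (V @^-1` A) = mu A.

End Probability.

Record cond_pmf (R : realType) (d : measure_display) (W : measurableType d)
    (C : finType) := CondPmf {
  pmf :> W -> C -> R ;
  pmf_ge0 : forall w c, 0 <= pmf w c ;
  pmf_sum1 : forall w, \sum_(c : C) pmf w c = 1 ;
  pmf_measurable : forall c, measurable_fun [set: W] (fun w => pmf w c) }.

Notation input R dnum C := (dnum.-tuple R * categories C)%type.

Notation encoder R dnum C l := {mfun (input R dnum C) >-> (l.-tuple R)}.

Notation num_decoder R l m dnum :=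
  {mfun (l.-tuple R * m.-tuple R)%type >-> (dnum.-tuple R)}.

Notation cat_decoder R l C := (cond_pmf R (l.-tuple R) (categories C)).

Section Losses.
Context {R : realType} {dnum l m dcat : nat} {C : 'I_dcat -> finPointedType}.
Context {d : measure_display} {Omega : measurableType d}.
Variables (P : probability Omega R) (X : {RV P >-> input R dnum C}).
Local Open Scope ereal_scope.

Section NumericalLoss.
Variables (eps eps' : {RV P >-> m.-tuple R}) (beta : R).

(* The conditional energy score given Z = z, where nu is the conditional law of
   X^num given Z = z. As the noise is independent of X, the conditional
   expectation of the first term is an iterated integral. *)
Definition energy_score (nu : {measure set (dnum.-tuple R) -> \bar R})
    (g : num_decoder R l m dnum) (z : l.-tuple R) : \bar R :=
  (\int[nu]_y \int[P]_w (euclid_dist y (g (z, eps w)) `^ beta)%:E)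
  - (2^-1)%:E *
    \int[P]_w (euclid_dist (g (z, eps w)) (g (z, eps' w)) `^ beta)%:E.

(* K is the conditional law of X^num given e(X). *)
Definition loss_num (K : R.-pker (l.-tuple R) ~> (dnum.-tuple R))
    (e : encoder R dnum C l) (g : num_decoder R l m dnum) : \bar R :=
  \int[distribution P (e \o X)]_z energy_score (K z) g z.

End NumericalLoss.

(* E[-log q(X^cat | W)]; note that lne 0 = -oo. *)
Definition log_loss (dW : measure_display) (TW : measurableType dW)
    (W : Omega -> TW) (q : cond_pmf R TW (categories C)) : \bar R :=
  \int[P]_w (- lne (q (W w) (X w).2)%:E).

Definition loss_cat (e : encoder R dnum C l) (q : cat_decoder R l C) : \bar R :=
  log_loss (fun w => e (X w)) q.

Definition loss_cind (Theta Psi : Type)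
    (qtheta : Theta -> cond_pmf R (l.-tuple R) (categories C))
    (qpsi : Psi -> cond_pmf R (l.-tuple R * dnum.-tuple R)%type (categories C))
    (e : encoder R dnum C l) : \bar R :=
  ereal_inf [set log_loss (fun w => e (X w)) (qtheta theta)
            | theta in [set: Theta]]
  - ereal_inf [set log_loss (fun w => (e (X w), (X w).1)) (qpsi psi)
              | psi in [set: Psi]].

(* H(X^cat | W), where K is the conditional law of X^cat given W. *)
Definition cond_entropy (dW : measure_display) (TW : measurableType dW)
    (W : Omega -> TW) (K : R.-pker TW ~> categories C) : \bar R :=
  \int[P]_w (- \sum_(c : categories C)
    fine (K (W w) [set c]) * ln (fine (K (W w) [set c])))%R%:E.

(* I(X^num; X^cat | e(X)), where K and K' are the conditional laws of X^cat
   given e(X) and given (e(X), X^num). *)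
Definition cond_mutual_info (K : R.-pker (l.-tuple R) ~> categories C)
    (K' : R.-pker (l.-tuple R * dnum.-tuple R) ~> categories C)
    (e : encoder R dnum C l) : \bar R :=
  cond_entropy (fun w => e (X w)) K
  - cond_entropy (fun w => (e (X w), (X w).1)) K'.

(* E_X E_{Y, Y'} |Y - Y'|^beta, with Y, Y' independent draws from the
   conditional law K of X^num given e(X). *)
Definition cond_dispersion (beta : R)
    (K : R.-pker (l.-tuple R) ~> (dnum.-tuple R))
    (e : encoder R dnum C l) : \bar R :=
  \int[P]_w \int[K (e (X w))]_y \int[K (e (X w))]_y'
    (euclid_dist y y' `^ beta)%:E.

End Losses.

(* Main.v *)
Require Import Defs.
From HB Require Import structures.
From mathcomp Require Import all_boot all_order all_algebra.
From mathcomp Require Import all_classical all_reals all_analysis.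
From mathcomp Require Import measurable_realfun ring lra.

(* For a fixed encoder, strict propriety of the energy score and Gibbs'
   inequality bound the decoder losses below by half the conditional dispersion
   and by the conditional entropy, with equality exactly for the conditional
   laws. By (A1) the bounds are attained, and by (A2) the third loss is the
   conditional mutual information. Minimizing the total loss over the decoders
   therefore gives the objective of (ii), and a minimizer attains both bounds,
   which is (i).

   Strict propriety needs no Fourier analysis. The power |x|^beta is a mixture
   of the functions 1 - exp(-t|x|^2), so the energy distance of mu and nu is a
   mixture over t of the double integrals of exp(-t|x-y|^2) against mu - nu.
   These are nonnegative, because exp(2t<x,y>) expands into a sum of products
   f(x)f(y). If they vanish, positivity at mu - nu + a delta_z for small a shows
   that exp(-t|x-z|^2) has the same integral under mu and nu for all t and z,
   and the algebra generated by these functions has the indicator functions of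
   half-spaces as iterated bounded limits. *)

Set Implicit Arguments.
Unset Strict Implicit.
Unset Printing Implicit Defensive.

Import Order.TTheory GRing.Theory Num.Theory.
Import numFieldNormedType.Exports.

Local Open Scope classical_set_scope.
Local Open Scope ring_scope.

(** * Functionals with dominated convergence *)

(** Integration against mu - nu, and against mu - nu + a delta_z, is treated as an abstract linear
    functional on bounded measurable functions that commutes with bounded pointwise limits. Kernel
    positivity and uniqueness use nothing else. The double integral of the kernel is the functional
    applied twice, so the Gaussian series is truncated with a uniform bound, and measurability of
    the inner value is read off from the truncations. The other obstacle is infinity. Energies of
    arbitrary laws and losses of arbitrary decoders may be +oo, so the energy inequality is kept as
    a sum on both sides. Terms are cancelled or subtracted only once the moments in (A3), the
    finiteness of the set of categories, or a finite optimal value has made them finite. In the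
    energy score the only subtracted term is the self-energy of the decoder law, finite by (A3) at
    almost every z. *)

Section DominatedFunctionals.
Context {R : realType} {d : measure_display} {T : measurableType d}.
Implicit Types (f g : T -> R) (L : (T -> R) -> R).

Definition bounded_measurable f : Prop :=
  measurable_fun [set: T] f /\ exists M : R, forall x, `|f x| <= M.

(** An abstract stand-in for a finite signed measure. Limits are pointwise everywhere under a
    uniform bound, so point evaluations and differences of probability integrals both qualify. *)
Record dominated_functional L : Prop := DominatedFunctional {
  dfunD : forall f g, bounded_measurable f -> bounded_measurable g ->
    L (fun x => f x + g x) = L f + L g ;
  dfunZ : forall a f, bounded_measurable f -> L (fun x => a * f x) = a * L f ;
  dfun_bounded : exists c : R, forall f M, measurable_fun [set: T] f ->
    (forall x, `|f x| <= M) -> `|L f| <= c * M ;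
  dfun_cvg : forall (f_ : nat -> T -> R) f M,
    (forall n, measurable_fun [set: T] (f_ n)) ->
    (forall n x, `|f_ n x| <= M) ->
    (forall x, f_ n x @[n --> \oo] --> f x) ->
    L (f_ n) @[n --> \oo] --> L f }.

Lemma bounded_measurable_cst (a : R) : bounded_measurable (fun=> a).
Proof. by split => //; exists `|a|. Qed.

Lemma bounded_measurableD f g : bounded_measurable f -> bounded_measurable g ->
  bounded_measurable (fun x => f x + g x).
Proof.
move=> [mf [M fM]] [mg [N gN]]; split; first exact: measurable_funD.
by exists (M + N) => x; rewrite (le_trans (ler_normD _ _))// lerD.
Qed.

Lemma bounded_measurableM f g : bounded_measurable f -> bounded_measurable g ->
  bounded_measurable (fun x => f x * g x).
Proof.
move=> [mf [M fM]] [mg [N gN]]; split; first exact: measurable_funM.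
by exists (M * N) => x; rewrite normrM ler_pM.
Qed.

Lemma bounded_measurableZ (a : R) f : bounded_measurable f ->
  bounded_measurable (fun x => a * f x).
Proof. exact/bounded_measurableM/bounded_measurable_cst. Qed.

Lemma bounded_measurable_sum (I : Type) (s : seq I) (h : I -> T -> R) :
  (forall i, bounded_measurable (h i)) ->
  bounded_measurable (fun x => \sum_(i <- s) h i x).
Proof.
move=> mh; elim: s => [|i s IHs].
  by under [X in bounded_measurable X]eq_fun do rewrite big_nil;
    exact: bounded_measurable_cst.
under [X in bounded_measurable X]eq_fun do rewrite big_cons.
exact: bounded_measurableD.
Qed.

Lemma dfun_cst0 L : dominated_functional L -> L (fun=> 0) = 0.
Proof.
move=> dL; have := dfunZ dL 0 (bounded_measurable_cst 0).
by under eq_fun do rewrite mul0r; rewrite mul0r.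
Qed.

Lemma dfun_sum L (I : Type) (s : seq I) (h : I -> T -> R) :
  dominated_functional L -> (forall i, bounded_measurable (h i)) ->
  L (fun x => \sum_(i <- s) h i x) = \sum_(i <- s) L (h i).
Proof.
move=> dL mh; elim: s => [|i s IHs].
  by under eq_fun do rewrite big_nil; rewrite big_nil dfun_cst0.
under eq_fun do rewrite big_cons.
by rewrite big_cons -IHs dfunD//; exact: bounded_measurable_sum.
Qed.

Lemma dfun_eval z : dominated_functional (fun f => f z).
Proof.
split => //; exists 1 => f M _ fM; rewrite mul1r; exact: fM.
Qed.

Lemma dfun_lin L L' (a : R) :
  dominated_functional L -> dominated_functional L' ->
  dominated_functional (fun f => L f + a * L' f).
Proof.
move=> dL dL'; split.
- by move=> f g mf mg; rewrite !dfunD//; ring.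
- by move=> b f mf; rewrite !dfunZ//; ring.
- have [c cP] := dfun_bounded dL; have [c' c'P] := dfun_bounded dL'.
  exists (c + `|a| * c') => f M mf fM.
  rewrite (le_trans (ler_normD _ _))// mulrDl lerD ?cP// normrM -mulrA.
  by rewrite ler_wpM2l// c'P.
- move=> f_ f M mf fM ff; apply: cvgD; first exact: (dfun_cvg dL mf fM ff).
  by apply: cvgMl_tmp; exact: (dfun_cvg dL' mf fM ff).
Qed.

Section Rintegral.
Variable mu : probability T R.

Lemma bounded_measurable_integrable f : bounded_measurable f ->
  mu.-integrable [set: T] (EFin \o f).
Proof.
move=> [mf [M fM]]; apply/integrableP; split; first exact/measurable_EFinP.
apply: (@le_lt_trans _ _ (\int[mu]_x (cst M%:E x))%E).
  apply: ge0_le_integral => //=.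
  - by do 2 apply/measurableT_comp => //; exact/measurable_EFinP.
  - by move=> x _; rewrite lee_fin (le_trans _ (fM x)).
by rewrite integral_cst//= probability_setT mule1 ltry.
Qed.

Lemma EFin_Rintegral f : bounded_measurable f ->
  (\int[mu]_x f x)%:E = (\int[mu]_x (f x)%:E)%E.
Proof.
move=> mf; rewrite fineK//; apply: integrable_fin_num => //.
exact: bounded_measurable_integrable.
Qed.

Lemma dfun_Rintegral : dominated_functional (fun f => \int[mu]_x f x).
Proof.
split.
- by move=> f g mf mg; rewrite RintegralD//;
    exact: bounded_measurable_integrable.
- by move=> a f mf; rewrite RintegralZl//; exact: bounded_measurable_integrable.
- exists 1 => f M mf fM; have bf : bounded_measurable f by split => //;
    exists M.
  rewrite (le_trans (le_normr_Rintegral _ (bounded_measurable_integrable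
    bf)))//.
  rewrite (_ : 1 * M = \int[mu]_x M); last first.
    by rewrite Rintegral_cst//= probability_setT/= mulr1 mul1r.
  apply: le_Rintegral => //; apply: bounded_measurable_integrable.
    split; first exact: measurableT_comp.
    by exists M => x; rewrite normr_id.
  exact: bounded_measurable_cst.
- move=> f_ f M mf fM ff.
  have mlim : measurable_fun [set: T] f.
    by apply: (measurable_fun_cvg mf) => x _; exact: ff.
  have [] // := @dominated_convergence _ _ _ mu setT measurableT
    (fun n => EFin \o f_ n) (EFin \o f) (cst M%:E).
  + by move=> n; exact/measurable_EFinP.
  + exact/measurable_EFinP.
  + by apply: aeW => x _; apply: cvg_EFin; [exact: nearW|exact: ff].
  + by apply: (@bounded_measurable_integrable (cst M));
      exact: bounded_measurable_cst.
  + by apply: aeW => x n _; rewrite /= lee_fin.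
  + move=> intf _ cvgI.
    apply: fine_cvg; rewrite /= fineK//; exact: integrable_fin_num.
Qed.

End Rintegral.
End DominatedFunctionals.

(** * Positivity of the Gaussian kernel *)

Section ExponentialSeries.
Context {R : realType}.
Implicit Types x y : R.

Lemma cvg_series_expR x : series (exp_coeff x) n @[n --> \oo] --> expR x.
Proof. exact: is_cvg_series_exp_coeff. Qed.

Lemma series_exp_coeff_le x n : 0 <= x -> series (exp_coeff x) n <= expR x.
Proof.
move=> x0; apply: nondecreasing_cvgn_le; last exact: is_cvg_series_exp_coeff.
by apply/nondecreasing_seqP => k; rewrite seriesSr lerDl exp_coeff_ge0.
Qed.

Lemma exp_coeff_le_expR x n : 0 <= x -> exp_coeff x n <= expR x.
Proof.
move=> x0; apply: le_trans (series_exp_coeff_le n.+1 x0).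
by rewrite seriesSr lerDr sumr_ge0// => i _; exact: exp_coeff_ge0.
Qed.

Lemma normr_series_exp_coeff x n : `|series (exp_coeff x) n| <= expR `|x|.
Proof.
apply: le_trans (series_exp_coeff_le n (normr_ge0 x)).
apply: (le_trans (ler_norm_sum _ _ _)); apply: ler_sum => i _.
by rewrite /exp_coeff/= normrM normrX [X in _ * X]ger0_norm// invr_ge0.
Qed.

End ExponentialSeries.

Section GaussianKernel.
Context {R : realType} {n : nat}.
Local Notation T := (n.-tuple R).
Implicit Types (x y z s : T) (t : R).

Definition dotp x y : R := \sum_(i < n) tnth x i * tnth y i.

Definition gauss t x y : R := expR (- t * euclid_dist x y ^+ 2).

Lemma euclid_normE x : euclid_norm x ^+ 2 = dotp x x.
Proof.
rewrite sqr_sqrtr; last by apply: sumr_ge0 => i _; exact: sqr_ge0.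
by apply: eq_bigr => i _; rewrite expr2.
Qed.

Lemma dotp_ge0 x : 0 <= dotp x x.
Proof. by rewrite -euclid_normE sqr_ge0. Qed.

Lemma dotpC x y : dotp x y = dotp y x.
Proof. by apply: eq_bigr => i _; rewrite mulrC. Qed.

Lemma euclid_dist_sqE x y :
  euclid_dist x y ^+ 2 = dotp x x + dotp y y - 2 * dotp x y.
Proof.
rewrite euclid_normE /dotp mulr_sumr -big_split -sumrB/=.
by apply: eq_bigr => i _; rewrite !tnth_mktuple; ring.
Qed.

Lemma gaussE t x y :
  gauss t x y = expR (- t * dotp x x) * expR (- t * dotp y y) *
                expR (2 * t * dotp x y).
Proof. by rewrite -!expRD /gauss euclid_dist_sqE; congr expR; ring. Qed.

Lemma gaussC t x y : gauss t x y = gauss t y x.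
Proof. by rewrite !gaussE dotpC mulrAC mulrC mulrA mulrAC. Qed.

Lemma normr_dotp x y : 2 * `|dotp x y| <= dotp x x + dotp y y.
Proof.
have h0 : 0 <= dotp x x + dotp y y - 2 * dotp x y.
  by rewrite -euclid_dist_sqE sqr_ge0.
have h1 : 0 <= dotp x x + dotp y y + 2 * dotp x y.
  rewrite /dotp mulr_sumr -!big_split/=; apply: sumr_ge0 => i _.
  rewrite (_ : _ + _ = (tnth x i + tnth y i) ^+ 2) ?sqr_ge0//; ring.
by case: (ger0P (dotp x y)) => _; lra.
Qed.

Lemma measurable_dotp y : measurable_fun [set: T] (dotp^~ y).
Proof.
apply: measurable_sum => i.
by apply: measurable_funM => //; exact: measurable_tnth.
Qed.

Lemma measurable_dotpxx : measurable_fun [set: T] (fun x => dotp x x).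
Proof.
apply: measurable_sum => i.
by apply: measurable_funM; exact: measurable_tnth.
Qed.

Lemma measurable_gauss t y : measurable_fun [set: T] (gauss t ^~ y).
Proof.
rewrite (_ : (gauss t ^~ y) = (fun x => expR (- t * dotp x x) *
    expR (- t * dotp y y) * expR (2 * t * dotp x y))); last first.
  by apply/funext => x; exact: gaussE.
apply: measurable_funM; first apply: measurable_funM => //.
- apply: measurableT_comp => //; apply: measurable_funM => //.
  exact: measurable_dotpxx.
- by apply: measurableT_comp => //; apply: measurable_funM => //;
    exact: measurable_dotp.
Qed.

Lemma gauss_ge0 t x y : 0 <= gauss t x y.
Proof. exact: expR_ge0. Qed.

Lemma gauss_le1 t x y : 0 <= t -> gauss t x y <= 1.
Proof. by move=> t0; rewrite expR_le1 mulNr oppr_le0 mulr_ge0// sqr_ge0. Qed.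

Lemma bounded_measurable_gauss t y : 0 <= t ->
  bounded_measurable (gauss t ^~ y).
Proof.
move=> t0; split; first exact: measurable_gauss.
by exists 1 => x; rewrite ger0_norm ?gauss_ge0// gauss_le1.
Qed.

Lemma bounded_measurable_gaussr t x : 0 <= t -> bounded_measurable (gauss t x).
Proof.
move=> t0; rewrite (_ : gauss t x = gauss t ^~ x).
  exact: bounded_measurable_gauss.
by apply/funext => y; exact: gaussC.
Qed.

(** Up to the constants of the exponential series, these are the coordinates of a feature map of the
    Gaussian kernel. A word [f] of length [k] names a monomial of degree [k], and the factor
    exp(-t|x|^2) keeps it bounded, hence within reach of the functionals. *)
Definition feature t k (f : {ffun 'I_k -> 'I_n}) x : R :=
  (\prod_(j < k) tnth x (f j)) * expR (- t * dotp x x).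

(* Multinomial expansion of [dotp x y ^+ k], indexed by words rather than by
   multi-indices so that no multinomial coefficients occur. *)
Lemma sum_feature t k x y : \sum_f feature t f x * @feature t k f y =
  dotp x y ^+ k * expR (- t * dotp x x) * expR (- t * dotp y y).
Proof.
rewrite -[in RHS](card_ord k) -prodr_const bigA_distr_bigA/= !mulr_suml.
apply: eq_bigr => f _; rewrite /feature big_split/=; ring.
Qed.

Lemma bounded_measurable_feature t k (f : {ffun 'I_k -> 'I_n}) : 0 < t ->
  bounded_measurable (feature t f).
Proof.
move=> t0; split.
  apply: measurable_funM.
    by apply: measurable_prod => j _; exact: measurable_tnth.
  apply: measurableT_comp => //; apply: measurable_funM => //.
  exact: measurable_dotpxx.
(* The squares of all features of degree [k] sum to |x|^(2k) exp(-2t|x|^2), and the [k]-th term of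
   the exponential series at 2t|x|^2 bounds this by [B]. Then 2|a| <= 1 + a^2 passes from the square
   to the feature itself. *)
pose B : R := k`!%:R / (2 * t) ^+ k.
exists (1 + B) => x.
have fB : feature t f x ^+ 2 <= B.
  apply: (@le_trans _ _ (\sum_f feature t f x * @feature t k f x)).
    rewrite (bigD1 f)//= -expr2 lerDl sumr_ge0// => g _.
    by rewrite -expr2 sqr_ge0.
  rewrite sum_feature -mulrA -expRD.
  rewrite (_ : _ + _ = - (2 * t * dotp x x)); last by ring.
  rewrite expRN -/(_ / _) ler_pdivrMr ?expR_gt0//.
  have := @exp_coeff_le_expR _ (2 * t * dotp x x) k.
  rewrite mulr_ge0 ?dotp_ge0 ?mulr_ge0 ?(ltW t0)// => /(_ isT).
  rewrite /exp_coeff/= exprMn ler_pdivrMr ?ltr0n ?fact_gt0// => h.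
  rewrite /B mulrAC ler_pdivlMr ?exprn_gt0 ?mulr_gt0//.
  by rewrite mulrC [X in _ <= X]mulrC.
have : 0 <= (`|feature t f x| - 1) ^+ 2 by exact: sqr_ge0.
rewrite -real_normK ?num_real// in fB.
have := normr_ge0 (feature t f x).
by nra.
Qed.

Definition gauss_sum t N x y : R :=
  \sum_(0 <= k < N) (2 * t) ^+ k / k`!%:R *
    \sum_f feature t f x * @feature t k f y.

Lemma gauss_sumE t N x y : gauss_sum t N x y =
  series (exp_coeff (2 * t * dotp x y)) N *
    (expR (- t * dotp x x) * expR (- t * dotp y y)).
Proof.
rewrite /series /= mulr_suml; apply: eq_bigr => k _.
rewrite sum_feature /exp_coeff/= [in RHS](exprMn k (2 * t)); ring.
Qed.

Lemma cvg_gauss_sum t x y : gauss_sum t N x y @[N --> \oo] --> gauss t x y.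
Proof.
under eq_cvg do rewrite gauss_sumE.
by rewrite gaussE mulrC; apply: cvgMr_tmp; exact: cvg_series_expR.
Qed.

(** The bound is uniform in [N] and in the points, as dominated convergence requires: the partial
    sum is at most exp(2t|<x,y>|), which the two Gaussian factors absorb because 2|<x,y>| <= |x|^2 +
    |y|^2. *)
Lemma gauss_sum_le1 t N x y : 0 <= t -> `|gauss_sum t N x y| <= 1.
Proof.
move=> t0; rewrite gauss_sumE normrM [X in _ * X]ger0_norm; last first.
  by rewrite mulr_ge0// expR_ge0.
apply: (@le_trans _ _ (expR `|2 * t * dotp x y| *
   (expR (- t * dotp x x) * expR (- t * dotp y y)))).
  by rewrite ler_wpM2r ?mulr_ge0 ?expR_ge0// normr_series_exp_coeff.
rewrite -!expRD expR_le1 normrM ger0_norm ?mulr_ge0//.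
have := ler_wpM2l t0 (normr_dotp x y).
by rewrite !mulNr mulrDr; lra.
Qed.

Lemma bounded_measurable_gauss_term t k y : 0 < t ->
  bounded_measurable (fun x =>
    (2 * t) ^+ k / k`!%:R * \sum_f feature t f y * @feature t k f x).
Proof.
move=> t0; apply/bounded_measurableZ/bounded_measurable_sum => f.
exact/bounded_measurableZ/bounded_measurable_feature.
Qed.

Lemma bounded_measurable_gauss_sum t N y : 0 < t ->
  bounded_measurable (gauss_sum t N y).
Proof.
by move=> t0; apply: bounded_measurable_sum => k;
  exact: bounded_measurable_gauss_term.
Qed.

Section functional.
Variables (t : R) (L : (T -> R) -> R).
Hypotheses (t0 : 0 < t) (dL : dominated_functional L).

Lemma dfun_gauss_sum N x : L (gauss_sum t N x) = \sum_(0 <= k < N)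
  (2 * t) ^+ k / k`!%:R * \sum_f L (feature t f) * @feature t k f x.
Proof.
have mphi k (f : {ffun 'I_k -> 'I_n}) := bounded_measurable_feature f t0.
rewrite dfun_sum//; last by move=> k; exact: bounded_measurable_gauss_term.
apply: eq_bigr => k _; rewrite dfunZ//; last first.
  by apply: bounded_measurable_sum => f; exact: bounded_measurableZ.
congr *%R; rewrite dfun_sum//; last by move=> f; exact: bounded_measurableZ.
by apply: eq_bigr => f _; rewrite dfunZ// mulrC.
Qed.

Lemma bounded_measurable_dfun_gauss_sum N :
  bounded_measurable (fun x => L (gauss_sum t N x)).
Proof.
under [X in bounded_measurable X]eq_fun do rewrite dfun_gauss_sum.
apply: bounded_measurable_sum => k; apply/bounded_measurableZ.
apply: bounded_measurable_sum => f; apply/bounded_measurableZ.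
exact: bounded_measurable_feature.
Qed.

Lemma cvg_dfun_gauss_sum x : L (gauss_sum t N x) @[N --> \oo] --> L (gauss t x).
Proof.
apply: (dfun_cvg dL (M := 1)).
- by move=> N; exact: (bounded_measurable_gauss_sum N x t0).1.
- by move=> N y; exact/gauss_sum_le1/ltW.
- by move=> y; exact: cvg_gauss_sum.
Qed.

Lemma dfun_gauss_sum_bounded :
  exists c, forall N x, `|L (gauss_sum t N x)| <= c.
Proof.
have [c cP] := dfun_bounded dL; exists (c * 1) => N x; apply: cP => [|y].
  exact: (bounded_measurable_gauss_sum N x t0).1.
exact/gauss_sum_le1/ltW.
Qed.

(** For an abstract [L], measurability in [x] cannot come from Fubini. It comes from the
    truncations, on which [L] yields a finite combination of features of [x]. *)
Lemma bounded_measurable_dfun_gauss :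
  bounded_measurable (fun x => L (gauss t x)).
Proof.
have [c cP] := dfun_bounded dL; split.
  apply: (measurable_fun_cvg (h := fun N x => L (gauss_sum t N x))).
    by move=> N; exact: (bounded_measurable_dfun_gauss_sum N).1.
  by move=> x _; exact: cvg_dfun_gauss_sum.
exists (c * 1) => x; apply: cP => [|y].
  exact: (bounded_measurable_gaussr x (ltW t0)).1.
by rewrite ger0_norm ?gauss_ge0// gauss_le1// ltW.
Qed.

(* The double integral of the kernel against [L] is the limit of sums of
   nonnegative multiples of the squares [L (feature t f) ^+ 2]. *)
Lemma gauss_positive : 0 <= L (fun x => L (gauss t x)).
Proof.
have mphi k (f : {ffun 'I_k -> 'I_n}) := bounded_measurable_feature f t0.
have outer_ge0 N : 0 <= L (fun x => L (gauss_sum t N x)).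
  under [X in L X]eq_fun do rewrite dfun_gauss_sum.
  rewrite dfun_sum//; last first.
    move=> k; apply/bounded_measurableZ/bounded_measurable_sum => f.
    exact: bounded_measurableZ.
  apply: sumr_ge0 => k _; rewrite dfunZ//; last first.
    by apply: bounded_measurable_sum => f; exact: bounded_measurableZ.
  rewrite mulr_ge0 ?divr_ge0 ?exprn_ge0 ?mulr_ge0// ?(ltW t0)//.
  rewrite dfun_sum//; last by move=> f; exact: bounded_measurableZ.
  by apply: sumr_ge0 => f _; rewrite dfunZ// -expr2 sqr_ge0.
have [c cP] := dfun_gauss_sum_bounded.
have cvg_outer : L (fun x => L (gauss_sum t N x)) @[N --> \oo] -->
    L (fun x => L (gauss t x)).
  apply: (dfun_cvg dL (M := c)) => // [N|x].
    exact: (bounded_measurable_dfun_gauss_sum N).1.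
  exact: cvg_dfun_gauss_sum.
rewrite -(cvg_lim _ cvg_outer)//; apply: limr_ge.
  by apply/cvg_ex; eexists; exact: cvg_outer.
exact: nearW.
Qed.

End functional.

(* Positivity at [L + a * (evaluation at z)], for [a := - L (gauss t z)]. *)
Lemma gauss_null t z L : 0 < t -> dominated_functional L ->
  L (fun x => L (gauss t x)) = 0 -> L (gauss t z) = 0.
Proof.
move=> t0 dL L0; set a := L (gauss t z).
have := gauss_positive t0 (dfun_lin (- a) dL (dfun_eval z)).
have bg x := bounded_measurable_gauss x (ltW t0).
rewrite /= dfunD//; last 2 first.
  exact: bounded_measurable_dfun_gauss.
  exact: bounded_measurableZ.
rewrite L0 add0r dfunZ// (_ : (fun x => gauss t x z) = gauss t z); last first.
  by apply/funext => x; exact: gaussC.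
rewrite -/a; have := gauss_le1 z z (ltW t0); have := sqr_ge0 a.
set g := gauss t z z => a0 g1 h.
(* After expansion the positivity reads 0 <= (g - 2) a^2, while g <= 1. *)
have {h} : a ^+ 2 <= 0 by nra.
by rewrite le_eqVlt ltNge a0 orbF sqrf_eq0 => /eqP.
Qed.

End GaussianKernel.

(** * Gaussian integrals determine a measure *)

Section GaussianUniqueness.
Context {R : realType} {n : nat}.
Local Notation T := (n.-tuple R).
Implicit Types (x y z s : T) (t : R) (f h : T -> R).

(** Completing the square shows that these are the Gaussians centred at s/(2t), up to a positive
    constant. In this form a product of two members of the family is again a member. *)
Definition tilt t s x : R := expR (- t * dotp x x + dotp s x).

Definition tilt_center t s : T := [tuple tnth s i / (2 * t) | i < n].

Lemma tiltE t s : 0 < t -> tilt t s = fun x =>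
  expR (t * dotp (tilt_center t s) (tilt_center t s)) *
  gauss t (tilt_center t s) x.
Proof.
move=> t0; apply/funext => x; set z := tilt_center t s.
rewrite gaussE -!expRD /tilt; congr expR.
have -> : dotp z x = dotp s x / (2 * t).
  rewrite /dotp mulr_suml; apply: eq_bigr => i _.
  by rewrite tnth_mktuple; ring.
by field; rewrite gt_eqF.
Qed.

Lemma bounded_measurable_tilt t s : 0 < t -> bounded_measurable (tilt t s).
Proof.
move=> t0; rewrite tiltE//.
exact/bounded_measurableZ/bounded_measurable_gaussr/ltW.
Qed.

Lemma tiltM t t' s s' x : tilt t s x * tilt t' s' x =
  tilt (t + t') [tuple tnth s i + tnth s' i | i < n] x.
Proof.
rewrite -expRD; congr expR.
have -> : dotp [tuple tnth s i + tnth s' i | i < n] x = dotp s x + dotp s' x.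
  rewrite -big_split/=; apply: eq_bigr => i _.
  by rewrite tnth_mktuple mulrDl.
by ring.
Qed.

Lemma cvg_tilt s x : tilt k.+1%:R^-1 s x @[k --> \oo] --> expR (dotp s x).
Proof.
apply: continuous_cvg; first exact: continuous_expR.
rewrite -[X in _ --> X]add0r -(mul0r (dotp x x)).
apply: cvgD; last exact: cvg_cst.
by apply: cvgMr_tmp; rewrite -oppr0; apply: cvgN; exact: cvg_harmonic.
Qed.

Variable L : (T -> R) -> R.
Hypothesis dL : dominated_functional L.
Hypothesis Lgauss : forall t z, 0 < t -> L (gauss t z) = 0.

Let L_tilt t s : 0 < t -> L (tilt t s) = 0.
Proof.
move=> t0; rewrite tiltE// dfunZ//; first by rewrite Lgauss// mulr0.
exact/bounded_measurable_gaussr/ltW.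
Qed.

(* The multipliers of the space of [tilt_null] functions form an algebra that
   is closed under bounded pointwise limits and contains the tilts; hence the
   sets with a multiplier as indicator function form a sigma-algebra. *)
Definition tilt_null h : Prop := bounded_measurable h /\
  forall t s, 0 < t -> L (fun x => h x * tilt t s x) = 0.

Definition multiplier f : Prop := bounded_measurable f /\
  forall h, tilt_null h -> tilt_null (fun x => f x * h x).

Lemma tilt_null1 : tilt_null (fun=> 1).
Proof.
split; first exact: bounded_measurable_cst.
by move=> t s t0; under [X in L X]eq_fun do rewrite mul1r; exact: L_tilt.
Qed.

(** Closure under products is composition of the two multiplications. The [tilt_null] functions
    themselves have no such evident closure, which is why multipliers are introduced. *)
Lemma multiplierM f g : multiplier f -> multiplier g ->
  multiplier (fun x => f x * g x).
Proof.
move=> [bf mf] [bg mg]; split; first exact: bounded_measurableM.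
move=> h /mg/mf.
by under [X in tilt_null X]eq_fun do rewrite mulrA.
Qed.

Lemma multiplierD f g : multiplier f -> multiplier g ->
  multiplier (fun x => f x + g x).
Proof.
move=> [bf mf] [bg mg]; split; first exact: bounded_measurableD.
move=> h nh; have [bfh nfh] := mf _ nh; have [bgh ngh] := mg _ nh.
under [X in tilt_null X]eq_fun do rewrite mulrDl.
split; first exact: bounded_measurableD.
move=> t s t0; under [X in L X]eq_fun do rewrite mulrDl.
have bt := bounded_measurable_tilt s t0.
by rewrite dfunD//; [rewrite nfh// ngh// addr0|
  exact: bounded_measurableM..].
Qed.

Lemma multiplier_cst (a : R) : multiplier (fun=> a).
Proof.
split; first exact: bounded_measurable_cst.
move=> h [bh nh]; split; first exact: bounded_measurableZ.
move=> t s t0; under [X in L X]eq_fun do rewrite -mulrA.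
rewrite dfunZ ?nh ?mulr0//.
exact/bounded_measurableM/bounded_measurable_tilt.
Qed.

Lemma multiplier_tilt t s : 0 < t -> multiplier (tilt t s).
Proof.
move=> t0; have bt := bounded_measurable_tilt s t0; split => // h [bh nh].
split; first exact: bounded_measurableM.
move=> t' s' t'0.
under [X in L X]eq_fun do rewrite mulrAC mulrC tiltM.
by apply: nh; rewrite addr_gt0.
Qed.

Lemma multiplier_cvg (f_ : nat -> T -> R) f (M : R) :
  (forall k, multiplier (f_ k)) -> (forall k x, `|f_ k x| <= M) ->
  (forall x, f_ k x @[k --> \oo] --> f x) -> multiplier f.
Proof.
move=> mf fM ff.
have bf : bounded_measurable f.
  split; first apply: (measurable_fun_cvg (h := f_)) => [k|x _].
  - exact: (mf k).1.1.
  - exact: ff.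
  exists M => x; have cf : `|f_ k x| @[k --> \oo] --> `|f x| by exact: cvg_norm
    (ff x).
  rewrite -(cvg_lim _ cf)//; apply: limr_le; first by apply/cvg_ex; eexists;
    exact: cf.
  by apply: nearW => k; exact: fM.
split => // h nh; split; first exact: bounded_measurableM bf nh.1.
move=> t s t0; have bt := bounded_measurable_tilt s t0.
have [[mh [M' hM']] _] := nh.
have [mt [M'' tM'']] := bt.
have LE : L (fun x => f_ k x * h x * tilt t s x) @[k --> \oo] -->
    L (fun x => f x * h x * tilt t s x).
  apply: (dfun_cvg dL (M := M * M' * M'')).
  - move=> k; apply: measurable_funM => //; apply: measurable_funM => //.
    exact: (mf k).1.1.
  - by move=> k x; rewrite !normrM ler_pM// ?mulr_ge0// ler_pM.
  - by move=> x; do 2 apply: cvgMr_tmp; exact: ff.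
rewrite -(cvg_lim _ LE)//.
under eq_fun do rewrite ((mf _).2 _ nh).2//.
exact: lim_cst.
Qed.

Lemma multiplier_sum (I : Type) (r : seq I) (g : I -> T -> R) :
  (forall i, multiplier (g i)) -> multiplier (fun x => \sum_(i <- r) g i x).
Proof.
move=> mg; elim: r => [|i r IHr].
  by under [X in multiplier X]eq_fun do rewrite big_nil; exact: multiplier_cst.
under [X in multiplier X]eq_fun do rewrite big_cons; exact: multiplierD.
Qed.

Lemma multiplierX f k : multiplier f -> multiplier (fun x => f x ^+ k).
Proof.
move=> mf; elim: k => [|k IHk].
  by under [X in multiplier X]eq_fun do rewrite expr0; exact: multiplier_cst.
under [X in multiplier X]eq_fun do rewrite exprS; exact: multiplierM.
Qed.

Lemma multiplier_expR f : multiplier f -> multiplier (expR \o f).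
Proof.
move=> mf; have [_ [M fM]] := mf.1.
apply: (multiplier_cvg (f_ := fun k x => series (exp_coeff (f x)) k)
  (M := expR M)) => [k|k x|x].
- apply: multiplier_sum => i; apply: multiplierM; last exact: multiplier_cst.
  exact: multiplierX.
- by apply: (le_trans (normr_series_exp_coeff _ _)); rewrite ler_expR.
- exact: cvg_series_expR.
Qed.

(** The function exp(<s,x>) is unbounded, so it is not itself a multiplier in general. It is a
    pointwise limit of tilts, and x -> exp(-a x) maps the nonnegative values of these tilts into
    [0, 1], which restores the uniform bound. *)
Lemma multiplier_expRN (a : R) s : 0 <= a ->
  multiplier (fun x => expR (- (a * expR (dotp s x)))).
Proof.
move=> a0.
apply: (multiplier_cvg (f_ := fun k x => expR (- a * tilt k.+1%:R^-1 s x))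
  (M := 1)) => [k|k x|x].
- apply: (multiplier_expR (f := fun x => - a * tilt k.+1%:R^-1 s x)).
  by apply: multiplierM; [exact: multiplier_cst|exact: multiplier_tilt].
- by rewrite ger0_norm ?expR_ge0// expR_le1 mulNr oppr_le0 mulr_ge0 ?expR_ge0.
- apply: continuous_cvg; first exact: continuous_expR.
  by rewrite -mulNr; apply: cvgMl_tmp; exact: cvg_tilt.
Qed.

(* [k * exp (k * (x_i - a))] tends to [0] if [x_i < a] and to [+oo] otherwise;
   the factor [k] settles the case [x_i = a]. *)
Lemma multiplier_halfspace (i : 'I_n) (a : R) :
  multiplier \1_[set x | tnth x i < a].
Proof.
pose s k := [tuple (k%:R : R) *+ (j == i) | j < n].
have sE k x : dotp (s k) x = k%:R * tnth x i.
  rewrite /dotp (bigD1 i)//= tnth_mktuple eqxx mulr1n big1 ?addr0// => j ji.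
  by rewrite tnth_mktuple (negbTE ji) mulr0n mul0r.
apply: (multiplier_cvg
  (f_ := fun k x => expR (- (k%:R * expR (- (k%:R * a)) * expR (dotp (s k) x))))
  (M := 1)) => [k|k x|x].
- by apply: multiplier_expRN; rewrite mulr_ge0 ?expR_ge0.
- by rewrite ger0_norm ?expR_ge0// expR_le1 oppr_le0 !mulr_ge0 ?expR_ge0.
rewrite (_ : (fun k => _) = (fun k : nat =>
    expR (- (k%:R * expR (k%:R * (tnth x i - a)))))); last first.
  apply/funext => k; rewrite -mulrA -expRD sE; congr (expR (- (_ * expR _))).
  by ring.
rewrite indicE; have [xa|ax] := ltP (tnth x i) a.
  rewrite mem_set// [X in _ --> X](_ : _ = expR (- 0)); last first.
    by rewrite oppr0 expR0.
  apply: continuous_cvg; first exact: continuous_expR.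
  apply: cvgN.
  pose b := a - tnth x i; have b0 : 0 < b by rewrite subr_gt0.
  (* The quadratic term of the exponential series gives (kb)^2 / 2 <= exp(kb), hence k exp(-kb) <= 2
     / (b^2 k). *)
  apply: (@squeeze_cvgr _ _ _ _ (fun=> 0) (fun k : nat => 2 / b ^+ 2 * k%:R^-1
    : R)).
  - near=> k; have k0 : (0 : R) < k%:R by rewrite ltr0n; near: k; exists 1%N.
    rewrite mulr_ge0 ?expR_ge0//=.
    rewrite (_ : k%:R * (_ - _) = - (k%:R * b)); last by rewrite /b; ring.
    rewrite expRN ler_pdivrMr ?expR_gt0//.
    have := @exp_coeff_le_expR _ (k%:R * b) 2.
    rewrite mulr_ge0 ?(ltW b0)// => /(_ isT); rewrite /exp_coeff/= => h.
    apply: le_trans (ler_wpM2l _ h); last first.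
      by rewrite mulr_ge0 ?invr_ge0 ?divr_ge0 ?sqr_ge0.
    rewrite le_eqVlt; apply/orP; left; apply/eqP.
    by rewrite (_ : (2`! = 2)%N)//; field; rewrite !gt_eqF.
  - exact: cvg_cst.
  - rewrite -(mulr0 (2 / b ^+ 2)); apply: cvgMl_tmp.
    apply/gtr0_cvgV0; last exact: cvgr_idn.
    by near=> k; rewrite ltr0n; near: k; exists 1%N.
rewrite memNset/=; last by apply/negP; rewrite -leNgt.
apply: (@squeeze_cvgr _ _ _ _ (fun=> 0) (fun k : nat => expR (- k%:R))).
- apply: nearW => k; rewrite expR_ge0/= ler_expR lerN2 ler_peMr//.
  by rewrite -expR0 ler_expR mulr_ge0// subr_ge0.
- exact: cvg_cst.
- exact: cvgn_expR.
Unshelve. all: by end_near. Qed.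

Lemma multiplier_sigma_algebra :
  sigma_algebra [set: T] [set A | multiplier \1_A].
Proof.
have mC A : multiplier \1_A -> multiplier \1_(~` A).
  move=> mA; rewrite (_ : \1_(~` A) = fun x => 1 + -1 * \1_A x).
    apply: multiplierD; first exact: multiplier_cst.
    by apply: multiplierM => //; exact: multiplier_cst.
  by apply/funext => x; rewrite !indicE in_setC; case: (x \in A) => /=; ring.
split => [|A mA|A mA]; rewrite /mkset.
- by rewrite indic0; exact: multiplier_cst.
- by rewrite setTD; exact: mC.
(* A countable union is the complement of a limit of finite intersections, whose indicators are
   finite products. *)
- have mI k : multiplier \1_(\bigcap_(j < k) ~` A j).
    rewrite bigcap_mkord; elim: k => [|k IHk].
      by rewrite big_ord0 indicT; exact: multiplier_cst.
    rewrite big_ord_recr/= indicI.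
    exact: (multiplierM IHk (mC _ (mA k))).
  rewrite -[\bigcup_k A k]setCK; apply: mC.
  apply: (multiplier_cvg (f_ := fun k => \1_(\bigcap_(j < k) ~` A j)) (M :=
    1)) => //.
    by move=> k x; rewrite indicE ger0_norm// lern1 leq_b1.
  move=> x; rewrite setC_bigcup.
  have [xA|/existsNP[j /not_implyP[_ Aj]]] := pselect ((\bigcap_k ~` A k) x).
    rewrite indicE mem_set//; apply: cvg_near_cst; apply: nearW => k.
    by rewrite indicE mem_set// => j _; exact: xA.
  rewrite indicE memNset/=; last by move/(_ j Logic.I).
  apply: cvg_near_cst; near=> k; rewrite indicE memNset// => h; apply/Aj/h.
  by near: k; exists j.+1.
Unshelve. all: by end_near. Qed.

Lemma multiplier_indic (A : set T) : measurable A -> multiplier \1_A.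
Proof.
suff : measurable `<=` [set A : set T | multiplier \1_A] by exact.
apply: smallest_sub; first exact: multiplier_sigma_algebra.
rewrite -bigcup_seq => B [i _ [C mC <-]].
(* For a fixed coordinate, the sets of reals whose preimage has a multiplier as indicator form a
   sigma-algebra, so it is enough to treat the open rays that generate the Borel sets. *)
suff : measurable `<=` image_set_system [set: T] (fun x => tnth x i)
    [set A : set T | multiplier \1_A] by exact.
rewrite -[measurable]/((@ocitv R).-sigma.-measurable) RGenInftyO.measurableE.
apply: smallest_sub.
  exact/sigma_algebra_image/multiplier_sigma_algebra.
move=> D [a ->]; rewrite /image_set_system /mkset setTI.
rewrite (_ : _ @^-1` _ = [set x | tnth x i < a]);
  first exact: multiplier_halfspace.
by apply/seteqP; split => x /=; rewrite in_itv.
Qed.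

(** Applying the multiplier to the constant 1 makes the integral of the indicator against every tilt
    vanish. With [s = 0] and t = 1/(k+1) the tilt tends boundedly to 1 and disappears in the
    limit. *)
Lemma gauss_uniqueness (A : set T) : measurable A -> L \1_A = 0.
Proof.
move=> mA; have [bA nA] := (multiplier_indic mA).2 _ tilt_null1.
pose z : T := [tuple 0 | i < n].
have dz x : dotp z x = 0.
  by rewrite /dotp big1// => i _; rewrite tnth_mktuple mul0r.
have LE : L (fun x => \1_A x * 1 * tilt k.+1%:R^-1 z x) @[k --> \oo] -->
    L \1_A.
  apply: (dfun_cvg dL (M := 1)).
  - move=> k; apply: measurable_funM; first exact: bA.1.
    exact: (bounded_measurable_tilt _ _).1.
  - move=> k x; rewrite mulr1 normrM indicE.
    case: (x \in A) => /=; last by rewrite normr0 mul0r.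
    rewrite normr1 mul1r ger0_norm ?expR_ge0// expR_le1 dz addr0.
    by rewrite mulNr oppr_le0 mulr_ge0 ?dotp_ge0.
  - move=> x; rewrite mulr1 -[X in _ --> X]mulr1.
    by apply: cvgMl_tmp; have := @cvg_tilt z x; rewrite dz expR0.
rewrite -(cvg_lim _ LE)//.
by under eq_fun do rewrite nA//; exact: lim_cst.
Qed.

End GaussianUniqueness.

(** * Strict propriety of the energy score *)

Section PowerMixture.
Context {R : realType}.
Variable beta : R.
Hypotheses (beta_gt0 : 0 < beta) (beta_lt2 : beta < 2).
Local Notation leb := (@lebesgue_measure R).

(* The classical representation of [r `^ beta] as a multiple of the integral of
   [(1 - exp (- t * r ^ 2)) * t ^ (- 1 - beta / 2)] over [t > 0], after the
   substitution [t = exp u], which turns scaling into translation. *)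
Definition mixture (u r : R) : R :=
  (1 - expR (- expR u * r ^+ 2)) * expR (- (beta / 2 * u)).

Definition mixture_cst : \bar R := (\int[leb]_u (mixture u 1)%:E)%E.

Lemma mixture_ge0 u r : 0 <= mixture u r.
Proof.
rewrite mulr_ge0 ?expR_ge0// subr_ge0 expR_le1 mulNr oppr_le0.
by rewrite mulr_ge0 ?expR_ge0 ?sqr_ge0.
Qed.

Lemma continuous_mixture r : continuous (mixture ^~ r).
Proof.
move=> u; apply: cvgM.
  apply: cvgB; first exact: cvg_cst.
  apply: continuous_cvg; first exact: continuous_expR.
  by apply: cvgMr_tmp; apply: cvgN; exact: continuous_expR.
apply: continuous_cvg; first exact: continuous_expR.
by apply: cvgN; apply: cvgMl_tmp; exact: cvg_id.
Qed.

Lemma measurable_mixture r : measurable_fun [set: R] (mixture ^~ r).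
Proof. by apply: continuous_measurable_fun; exact: continuous_mixture. Qed.

Lemma mixture_shift (u r : R) : 0 < r ->
  mixture (u + 2 * ln r) 1 = mixture u r * (r `^ beta)^-1.
Proof.
move=> r0; rewrite /mixture expr1n mulr1 -[RHS]mulrA; congr *%R.
  congr (1 - expR _); rewrite expRD (_ : expR (2 * ln r) = r ^+ 2) ?mulNr//.
  by rewrite -[2]/(2%:R) expRM_natl lnK.
rewrite /powR gt_eqF// -expRN -expRD; congr expR.
by field.
Qed.

Lemma integral_mixture (r : R) : 0 <= r ->
  (\int[leb]_u (mixture u r)%:E = (r `^ beta)%:E * mixture_cst)%E.
Proof.
rewrite le_eqVlt => /predU1P[<-|r0].
  rewrite powR0 ?gt_eqF// mul0e integral0_eq// => u _.
  by rewrite /mixture expr0n mulr0 expR0 subrr mul0r.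
pose F := (fun u => u + 2 * ln r) : R -> R.
have dF : (F^`())%classic = cst 1.
  apply/funext => u; rewrite derive1E deriveD//= derive_id.
  by rewrite derive_cst addr0.
rewrite /mixture_cst [in RHS](@increasing_ge0_integration_by_substitutionT _ F);
  last first.
- by move=> u; exact: mixture_ge0.
- exact: continuous_mixture.
- exact: cvg_addrr.
- exact: cvg_addrr_Ny.
- by move=> u; apply: derivableD.
- by rewrite dF; exact: is_cvg_cst.
- by rewrite dF; exact: is_cvg_cst.
- by rewrite dF; exact: cst_continuous.
- by move=> u v uv; rewrite ltrD2r.
rewrite dF (_ : (mixture ^~ 1 \o F) * cst 1 =
    (fun u => mixture u r * (r `^ beta)^-1)); last first.
  by apply/funext => u; rewrite -mixture_shift//=; exact: mulr1.
rewrite -ge0_integralZl//=.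
- apply: eq_integral => u _; rewrite -EFinM; congr EFin.
  by rewrite mulrCA divff ?mulr1// gt_eqF// powR_gt0.
- apply/measurable_EFinP; apply: measurable_funM => //.
  exact: measurable_mixture.
- by move=> u _; rewrite lee_fin mulr_ge0 ?mixture_ge0// invr_ge0 powR_ge0.
- by rewrite lee_fin powR_ge0.
Qed.

Lemma mixture_cst_gt0 : (0 < mixture_cst)%E.
Proof.
(* On [0, 1] one has exp(u) >= 1 and u <= 1, so [c] bounds the integrand from below there. *)
pose c : R := (1 - expR (- 1)) * expR (- beta / 2).
have c0 : 0 < c by rewrite mulr_gt0 ?expR_gt0// subr_gt0 expR_lt1 oppr_lt0.
apply: (@lt_le_trans _ _ (\int[leb]_(u in `[0%R, 1%R]) c%:E)%E).
  rewrite integral_cst//= lebesgue_measure_itv/= lte_fin ltr01 oppr0 adde0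
    mule1.
  by rewrite lte_fin.
apply: (@le_trans _ _ (\int[leb]_(u in `[0%R, 1%R]) (mixture u 1)%:E)%E).
  apply: ge0_le_integral => //=.
  - by move=> u _; rewrite lee_fin ltW.
  - by apply/measurable_EFinP/measurable_funTS; exact: measurable_mixture.
  - move=> u; rewrite in_itv/= => /andP[u0 u1]; rewrite lee_fin.
    rewrite ler_pM ?expR_ge0 ?subr_ge0 ?expR_le1 ?oppr_le0//.
    + rewrite expr1n mulr1 lerD2l lerN2 ler_expR lerN2.
      by rewrite (le_trans _ (expR_ge1Dx _))// lerDl.
    + by rewrite ler_expR mulNr lerN2 ler_piMr// divr_ge0// ltW.
apply: ge0_subset_integral => //=.
- by apply/measurable_EFinP; exact: measurable_mixture.
- by move=> u _; rewrite lee_fin mixture_ge0.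
Qed.

(** Each bound on [beta] controls one end. As u tends to +oo the integrand is at most exp(-beta u /
    2). As u tends to -oo, 1 - exp(-exp(u)) <= exp(u) leaves exp((1 - beta/2) u). The smaller of the
    two rates, [del], gives a symmetric majorant. *)
Lemma mixture_cst_lty : (mixture_cst < +oo)%E.
Proof.
pose del := Num.min (beta / 2) (1 - beta / 2).
have b1 : 0 < beta / 2 by rewrite divr_gt0.
have b2 : 0 < 1 - beta / 2 by rewrite subr_gt0 ltr_pdivrMr// mul1r.
have del0 : 0 < del by rewrite lt_min b1 b2.
have [d1 d2] : del <= beta / 2 /\ del <= 1 - beta / 2.
  by split; rewrite ge_min lexx ?orbT.
pose H (u : R) := expR (- (del * `|u|)).
have cH : continuous H.
  move=> u; apply: continuous_cvg; first exact: continuous_expR.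
  by apply: cvgN; apply: cvgMl_tmp; apply: cvg_norm; exact: cvg_id.
apply: (@le_lt_trans _ _ (\int[leb]_u (H u)%:E)%E).
  apply: ge0_le_integral => //=.
  - by move=> u _; rewrite lee_fin mixture_ge0.
  - by apply/measurable_EFinP; exact: measurable_mixture.
  - by apply/measurable_EFinP; exact: continuous_measurable_fun.
  - move=> u _; rewrite lee_fin /H /mixture expr1n mulr1.
    have [u0|u0] := leP 0 u.
      rewrite ger0_norm//; apply: (@le_trans _ _ (1 * expR (- (beta / 2 * u)))).
        by rewrite ler_wpM2r ?expR_ge0// gerBl expR_ge0.
      by rewrite mul1r ler_expR lerN2 ler_wpM2r.
    apply: (@le_trans _ _ (expR u * expR (- (beta / 2 * u)))).
      rewrite ler_wpM2r ?expR_ge0//.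
      by have := expR_ge1Dx (- expR u); lra.
    rewrite -expRD ler_expR ltr0_norm//.
    by have := ler_wnM2r (ltW u0) d2; lra.
rewrite ge0_symfun_integralT//; last 2 first.
- by move=> u; exact: expR_ge0.
- by move=> u; rewrite /H /= normrN.
rewrite (_ : (\int[_]_(_ in _) _ = del^-1%:E)%E) ?ltry//.
(* On the half-line, [H] is [del^-1] times the density of the exponential law of rate [del]. *)
transitivity (\int[leb]_u (del^-1%:E * (exponential_pdf del u)%:E))%E;
  last first.
  rewrite ge0_integralZl//=.
  - by rewrite integral_exponential_pdf// mule1.
  - by apply/measurable_EFinP; exact: measurable_exponential_pdf.
  - by move=> u _; rewrite lee_fin exponential_pdf_ge0// ltW.
  - by rewrite lee_fin invr_ge0 ltW.
rewrite integral_mkcond; apply: eq_integral => u _.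
rewrite patchE; case: ifPn => [|/negP]; rewrite inE/= => u0.
  rewrite exponential_pdfE// /H ger0_norm// -EFinM mulNr.
  by rewrite mulrA mulVf ?mul1r// gt_eqF.
by rewrite lt0_exponential_pdf ?mule0// ltNge; exact/negP.
Qed.

End PowerMixture.

Lemma ge0_integral_eq0_ae (R : realType) d (T : measurableType d)
    (mu : {measure set T -> \bar R}) (f : T -> \bar R) :
  (measurable_fun [set: T] f -> (forall x, 0 <= f x) -> \int[mu]_x f x = 0 ->
  {ae mu, forall x, f x = 0})%E.
Proof.
move=> mf f0 I0; have I : (\int[mu]_x `|f x| = 0)%E.
  by rewrite -[RHS]I0; apply: eq_integral => x _; rewrite gee0_abs.
have := (ae_eq_integral_abs mu measurableT mf).1 I.
by apply: filterS => x; apply.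
Qed.

Lemma ae_mono (R : realType) d (T : measurableType d)
    (mu : {measure set T -> \bar R}) (P Q : T -> Prop) :
  (forall x, P x -> Q x) -> {ae mu, forall x, P x} -> {ae mu, forall x, Q x}.
Proof. by move=> PQ; apply: filterS. Qed.

Section TripleTonelli.
Context {R : realType} {d1 d2 d3 : measure_display}.
Context {T1 : measurableType d1} {T2 : measurableType d2}.
Context {T3 : measurableType d3}.
Variable m1 : {sigma_finite_measure set T1 -> \bar R}.
Variable m2 : {sigma_finite_measure set T2 -> \bar R}.
Variable m3 : {sigma_finite_measure set T3 -> \bar R}.
Variable f : T1 -> T2 -> T3 -> \bar R.
Hypothesis mf : measurable_fun [set: (T1 * T3) * T2]
  (fun w => f w.1.1 w.2 w.1.2).
Hypothesis f0 : forall x y u, (0 <= f x y u)%E.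
Local Open Scope ereal_scope.

Let measurable_inner :
  measurable_fun [set: T1 * T3] (fun z => \int[m2]_y f z.1 y z.2).
Proof.
exact: (measurable_fun_fubini_tonelli_F
  (fun w : (T1 * T3) * T2 => f w.1.1 w.2 w.1.2)).
Qed.

Let inner_ge0 z : 0 <= \int[m2]_y f z.1 y z.2.
Proof. exact: integral_ge0. Qed.

Lemma measurable_triple_tonelli :
  measurable_fun [set: T3] (fun u => \int[m1]_x \int[m2]_y f x y u).
Proof.
exact: (measurable_fun_fubini_tonelli_G
  (fun z : T1 * T3 => \int[m2]_y f z.1 y z.2)).
Qed.

(** The variable u is moved past y for fixed x, then past x. Measurability is assumed with x and u
    paired, so that the integral over y is a function on a product to which Tonelli applies
    again. *)
Lemma triple_tonelli : \int[m1]_x \int[m2]_y \int[m3]_u f x y u =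
  \int[m3]_u \int[m1]_x \int[m2]_y f x y u.
Proof.
rewrite -(fubini_tonelli (fun z : T1 * T3 => \int[m2]_y f z.1 y z.2))//.
apply: eq_integral => x _.
rewrite (fubini_tonelli (fun z : T2 * T3 => f x z.1 z.2))//.
apply: (measurableT_comp mf (g := fun z : T2 * T3 => ((x, z.2), z.1))).
by apply: measurable_fun_pair => //; exact: measurable_fun_pair.
Qed.

End TripleTonelli.

(** * Energies of pairs of laws as mixtures of Gaussian means *)

Section EnergyDistance.
Context {R : realType} {n : nat}.
Local Notation T := (n.-tuple R).
Local Notation leb := (@lebesgue_measure R).

Lemma measurable_euclid_dist d (U : measurableType d) (f g : U -> T) :
  measurable_fun [set: U] f -> measurable_fun [set: U] g ->
  measurable_fun [set: U] (fun u => euclid_dist (f u) (g u)).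
Proof.
move=> mf mg; rewrite /euclid_dist /euclid_norm.
have ms : measurable_fun [set: R] (@Num.sqrt R).
  by apply: continuous_measurable_fun; exact: sqrt_continuous.
apply: (measurableT_comp ms).
apply: measurable_sum => i; apply: measurable_funX.
under [X in measurable_fun _ X]eq_fun do rewrite tnth_mktuple.
by apply: measurable_funB; apply: (measurableT_comp (measurable_tnth i)).
Qed.

Lemma measurable_euclid_dist_powR d (U : measurableType d) (f g : U -> T) beta :
  measurable_fun [set: U] f -> measurable_fun [set: U] g ->
  measurable_fun [set: U] (fun u => (euclid_dist (f u) (g u) `^ beta)%:E).
Proof.
move=> mf mg; apply/measurable_EFinP.
apply: (measurableT_comp (f := (@powR R)^~ beta)).
  exact: measurable_powR.
exact: measurable_euclid_dist.
Qed.

Lemma measurable_gauss2 t : measurable_fun [set: T * T] (fun z : T * T => gauss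
  t z.1 z.2).
Proof.
apply: measurableT_comp => //; apply: measurable_funM => //.
by apply: measurable_funX; exact: measurable_euclid_dist.
Qed.

Variable beta : R.
Hypotheses (beta_gt0 : 0 < beta) (beta_lt2 : beta < 2).

Definition energy (mu nu : probability T R) : \bar R :=
  (\int[mu]_x \int[nu]_y (euclid_dist x y `^ beta)%:E)%E.

Definition gauss_mean (mu nu : probability T R) (t : R) : R :=
  \int[mu]_x \int[nu]_y gauss t x y.

Lemma gauss_meanC mu nu (t : R) : 0 < t ->
  gauss_mean mu nu t = gauss_mean nu mu t.
Proof.
move=> t0; apply: EFin_inj.
have mg' x : bounded_measurable (@gauss R n t x).
  exact/bounded_measurable_gaussr/ltW.
rewrite /gauss_mean !EFin_Rintegral; last 2 first.
  exact: (bounded_measurable_dfun_gauss t0 (dfun_Rintegral mu)).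
  exact: (bounded_measurable_dfun_gauss t0 (dfun_Rintegral nu)).
under eq_integral do rewrite (EFin_Rintegral _ (mg' _)).
under [RHS]eq_integral do rewrite (EFin_Rintegral _ (mg' _)).
rewrite (@fubini_tonelli _ _ _ _ _ _ _ (fun z : T * T => (gauss t z.1
  z.2)%:E))/=.
- by apply: eq_integral => x _; apply: eq_integral => y _; rewrite gaussC.
- by apply/measurable_EFinP; exact: measurable_gauss2.
- by move=> z; rewrite lee_fin gauss_ge0.
Qed.

(** Written with [+ -1 *] so that it is an instance of [dfun_lin]. *)
Definition mean_diff (mu nu : probability T R) (f : T -> R) : R :=
  \int[mu]_x f x + -1 * \int[nu]_x f x.

Lemma dfun_mean_diff mu nu : dominated_functional (mean_diff mu nu).
Proof. by apply: dfun_lin; exact: dfun_Rintegral. Qed.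

Lemma mean_diff_gauss mu nu (t : R) : 0 < t ->
  mean_diff mu nu (fun x => mean_diff mu nu (gauss t x)) =
  gauss_mean mu mu t + gauss_mean nu nu t - gauss_mean mu nu t *+ 2.
Proof.
move=> t0; have dm := dfun_Rintegral mu; have dn := dfun_Rintegral nu.
have bm := bounded_measurable_dfun_gauss t0 dm.
have bn := bounded_measurable_dfun_gauss t0 dn.
rewrite [LHS]/mean_diff (dfunD dm)//; last exact: bounded_measurableZ.
rewrite (dfunD dn)//; last exact: bounded_measurableZ.
rewrite (dfunZ dm)// (dfunZ dn)// -!/(gauss_mean _ _ _) (gauss_meanC nu mu t0).
by ring.
Qed.

Lemma gauss_mean_le mu nu (t : R) : 0 < t ->
  gauss_mean mu nu t *+ 2 <= gauss_mean mu mu t + gauss_mean nu nu t.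
Proof.
move=> t0; rewrite -subr_ge0 -mean_diff_gauss//.
exact: gauss_positive (dfun_mean_diff mu nu).
Qed.

(** This is the mean of [mixture beta u] at the distance between independent draws from mu and nu.
    The explicit form shows that inequalities between Gaussian means reverse when they pass to the
    weights. *)
Definition gauss_weight (mu nu : probability T R) (u : R) : R :=
  (1 - gauss_mean mu nu (expR u)) * expR (- (beta / 2 * u)).

Lemma measurable_mixture_dist d (U : measurableType d) (a : U ->
  R) (f g : U -> T) :
  measurable_fun [set: U] a ->
  measurable_fun [set: U] f -> measurable_fun [set: U] g ->
  measurable_fun [set: U] (fun w => (mixture beta (a w) (euclid_dist (f w) (g
    w)))%:E).
Proof.
move=> ma mf mg; apply/measurable_EFinP; apply: measurable_funM.
  apply: measurable_funB => //; apply: measurableT_comp => //.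
  apply: measurable_funM; first by apply: measurable_funN;
    apply: measurableT_comp.
  by apply: measurable_funX; exact: measurable_euclid_dist.
apply: measurableT_comp => //; apply: measurable_funN.
exact: measurable_funM.
Qed.

Let measurable_mixture3 : measurable_fun [set: (T * R) * T]
  (fun w : (T * R) * T => (mixture beta w.1.2 (euclid_dist w.1.1 w.2))%:E).
Proof.
apply: measurable_mixture_dist.
- exact: (measurableT_comp measurable_snd measurable_fst).
- exact: (measurableT_comp measurable_fst measurable_fst).
- exact: measurable_snd.
Qed.

Let mixture3_ge0 (x y : T) u : (0 <= (mixture beta u (euclid_dist x y))%:E)%E.
Proof. by rewrite lee_fin mixture_ge0. Qed.

Lemma gauss_weightE mu nu u : (gauss_weight mu nu u)%:E =
  (\int[mu]_x \int[nu]_y (mixture beta u (euclid_dist x y))%:E)%E.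
Proof.
have u0 : 0 < expR u by exact: expR_gt0.
have mg' x : bounded_measurable (@gauss R n (expR u) x).
  exact/bounded_measurable_gaussr/ltW.
set w := expR (- (beta / 2 * u)).
have mixE x y : mixture beta u (euclid_dist x y) =
  w * (1 + -1 * gauss (expR u) x y).
  by rewrite /mixture /gauss -/w; ring.
have dn := dfun_Rintegral nu; have dm := dfun_Rintegral mu.
have bn : bounded_measurable (fun x => \int[nu]_y gauss (expR u) x y).
  exact: bounded_measurable_dfun_gauss.
have int1 (P : probability T R) : \int[P]_y 1 = 1 :> R.
  by rewrite Rintegral_cst//= probability_setT/= mulr1.
have inner x : (\int[nu]_y (mixture beta u (euclid_dist x y))%:E =
    (w * (1 + -1 * \int[nu]_y gauss (expR u) x y))%:E)%E.
  under eq_integral do rewrite mixE.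
  have b1 : bounded_measurable (fun y => 1 + -1 * gauss (expR u) x y).
    by apply: bounded_measurableD;
      [exact: bounded_measurable_cst|exact: bounded_measurableZ].
  rewrite -EFin_Rintegral; last exact: bounded_measurableZ.
  rewrite (dfunZ dn)// (dfunD dn); last 2 first.
    exact: bounded_measurable_cst.
    exact: bounded_measurableZ.
  by rewrite (dfunZ dn)// int1.
under eq_integral do rewrite inner.
have b1 : bounded_measurable (fun x => 1 + -1 * \int[nu]_y gauss (expR u) x y).
  by apply: bounded_measurableD;
    [exact: bounded_measurable_cst|exact: bounded_measurableZ].
rewrite -EFin_Rintegral; last exact: bounded_measurableZ.
rewrite (dfunZ dm)// (dfunD dm); last 2 first.
  exact: bounded_measurable_cst.
  exact: bounded_measurableZ.
rewrite (dfunZ dm)// int1 /gauss_weight /gauss_mean -/w.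
by congr EFin; ring.
Qed.

Lemma gauss_weight_ge0 mu nu u : 0 <= gauss_weight mu nu u.
Proof.
rewrite -lee_fin gauss_weightE; do 2 apply: integral_ge0 => ? _.
by rewrite lee_fin mixture_ge0.
Qed.

Lemma measurable_gauss_weight mu nu :
  measurable_fun [set: R] (gauss_weight mu nu).
Proof.
apply/measurable_EFinP.
rewrite (_ : _ \o _ = fun u : R =>
    (\int[mu]_x \int[nu]_y (mixture beta u (euclid_dist x y))%:E)%E).
  exact: (measurable_triple_tonelli mu nu measurable_mixture3 mixture3_ge0).
by apply/funext => u; exact: gauss_weightE.
Qed.

(** The constant is positive and finite, so keeping it as a factor loses nothing, and the identity
    also covers infinite energies. *)
Lemma energy_mixture mu nu : (energy mu nu * mixture_cst beta =
  \int[leb]_u (gauss_weight mu nu u)%:E)%E.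
Proof.
under [RHS]eq_integral do rewrite gauss_weightE.
rewrite -(triple_tonelli mu nu leb measurable_mixture3 mixture3_ge0)/=.
have mc0 : (0 <= mixture_cst beta)%E by exact/ltW/mixture_cst_gt0.
have d0 (z : T * T) : (0 <= (euclid_dist z.1 z.2 `^ beta)%:E)%E.
  by rewrite lee_fin powR_ge0.
have mE : measurable_fun [set: T * T]
    (fun z : T * T => (euclid_dist z.1 z.2 `^ beta)%:E).
  exact: measurable_euclid_dist_powR.
rewrite /energy -ge0_integralZr//; last 2 first.
- exact: (measurable_fun_fubini_tonelli_F _ mE d0).
- by move=> x _; apply: integral_ge0 => y _; exact: (d0 (x, y)).
apply: eq_integral => x _; rewrite -ge0_integralZr//; last 2 first.
- by apply: measurable_euclid_dist_powR.
- by move=> y _; exact: (d0 (x, y)).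
by apply: eq_integral => y _; rewrite integral_mixture// sqrtr_ge0.
Qed.

Lemma energy_ge0 mu nu : (0 <= energy mu nu)%E.
Proof.
by apply: integral_ge0 => x _; apply: integral_ge0 => y _;
  rewrite lee_fin powR_ge0.
Qed.

Let mcst_fin : mixture_cst beta \is a fin_num.
Proof.
rewrite ge0_fin_numE; first exact: mixture_cst_lty.
exact/ltW/mixture_cst_gt0.
Qed.

Lemma gauss_weight_le mu nu u :
  gauss_weight mu mu u + gauss_weight nu nu u <= gauss_weight mu nu u *+ 2.
Proof.
have := gauss_mean_le mu nu (expR_gt0 u); have := expR_gt0 (- (beta / 2 * u)).
by rewrite /gauss_weight; nra.
Qed.

Let energyD_mixture (m1 m2 m3 m4 : probability T R) :
  ((energy m1 m2 + energy m3 m4) * mixture_cst beta =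
  \int[leb]_u ((gauss_weight m1 m2 u)%:E + (gauss_weight m3 m4 u)%:E))%E.
Proof.
rewrite ge0_muleDl ?energy_ge0// !energy_mixture -ge0_integralD//.
- by move=> u _; rewrite lee_fin gauss_weight_ge0.
- by apply/measurable_EFinP; exact: measurable_gauss_weight.
- by move=> u _; rewrite lee_fin gauss_weight_ge0.
- by apply/measurable_EFinP; exact: measurable_gauss_weight.
Qed.

(** Nonnegativity of the energy distance, without differences because the energies may be infinite.
    After multiplication by the mixture constant it holds pointwise in u. *)
Lemma energy_le mu nu :
  (energy mu mu + energy nu nu <= energy mu nu + energy mu nu)%E.
Proof.
rewrite -(@lee_pmul2r _ (mixture_cst beta))// ?mixture_cst_gt0//.
rewrite !energyD_mixture.
have mw m1 m2 : measurable_fun [set: R] (fun u => (gauss_weight m1 m2 u)%:E).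
  by apply/measurable_EFinP; exact: measurable_gauss_weight.
have w0 m1 m2 u : (0 <= (gauss_weight m1 m2 u)%:E)%E.
  by rewrite lee_fin gauss_weight_ge0.
apply: ge0_le_integral => //=.
- by move=> u _; rewrite adde_ge0.
- by apply: emeasurable_funD; exact: mw.
- by apply: emeasurable_funD; exact: mw.
- by move=> u _; rewrite -!EFinD lee_fin -mulr2n gauss_weight_le.
Qed.

(** A null set cannot contain an interval of positive length. *)
Lemma ae_dense (Q : R -> Prop) (a e : R) : 0 < e ->
  {ae leb, forall u, Q u} -> exists2 u, a < u < a + e & Q u.
Proof.
move=> e0 [N [mN N0 QN]]; apply: contrapT => h.
have : (leb `]a, (a + e)%R[%classic <= leb N)%E.
  apply: le_measure; rewrite ?inE// => u; rewrite /= in_itv/= => uae.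
  by apply: QN => Qu; apply: h; exists u.
rewrite N0 lebesgue_measure_itv/= lte_fin ltrDl e0 -EFinB addrAC subrr add0r.
by rewrite lee_fin leNgt e0.
Qed.

(* The Gaussian double integrals against [mu - nu] vanish for almost every [u]
   and are continuous in [u]. *)
Lemma energy_eq mu nu : (energy mu nu < +oo ->
  energy mu nu + energy mu nu <= energy mu mu + energy nu nu ->
  forall A, measurable A -> mu A = nu A)%E.
Proof.
move=> fin le A mA.
have mw m1 m2 : measurable_fun [set: R] (fun u => (gauss_weight m1 m2 u)%:E).
  by apply/measurable_EFinP; exact: measurable_gauss_weight.
have w0 m1 m2 u : (0 <= (gauss_weight m1 m2 u)%:E)%E.
  by rewrite lee_fin gauss_weight_ge0.
pose gap u := gauss_weight mu nu u *+ 2 -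
  (gauss_weight mu mu u + gauss_weight nu nu u).
have gap0 u : 0 <= gap u by rewrite subr_ge0 gauss_weight_le.
have mgap : measurable_fun [set: R] (fun u => (gap u)%:E).
  apply/measurable_EFinP; apply: measurable_funB.
    by apply: measurable_funD; exact: measurable_gauss_weight.
  by apply: measurable_funD; exact: measurable_gauss_weight.
(* The self terms must be finite to be cancelled below. By [energy_le] they are dominated by the
   cross term, which is finite by assumption. *)
have cfin : (\int[leb]_u (gauss_weight mu mu u + gauss_weight nu nu u)%:E <
  +oo)%E.
  apply: (@le_lt_trans _ _
      ((energy mu nu + energy mu nu) * mixture_cst beta)%E); last first.
    have e0 := energy_ge0 mu nu.
    apply: lte_mul_pinfty; [exact: adde_ge0| |exact: mixture_cst_lty].
    by rewrite fin_numD !ge0_fin_numE// fin.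
  under eq_integral do rewrite EFinD.
  rewrite -energyD_mixture lee_pmul2r ?mixture_cst_gt0//; exact: energy_le.
have gapI : (\int[leb]_u (gap u)%:E = 0)%E.
  apply/eqP; rewrite eq_le integral_ge0 ?andbT; last first.
    by move=> u _; rewrite lee_fin.
  have : (\int[leb]_u ((gap u)%:E +
      (gauss_weight mu mu u + gauss_weight nu nu u)%:E) <=
      \int[leb]_u (gauss_weight mu mu u + gauss_weight nu nu u)%:E)%E.
    under eq_integral do rewrite -EFinD subrK mulr2n EFinD.
    under [leRHS]eq_integral do rewrite EFinD.
    by rewrite -!energyD_mixture lee_pmul2r ?mixture_cst_gt0.
  rewrite ge0_integralD//; last 3 first.
  - by move=> u _; rewrite lee_fin.
  - by move=> u _; rewrite EFinD adde_ge0.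
  - by under eq_fun do rewrite EFinD; apply: emeasurable_funD; exact: mw.
  rewrite -[X in (_ <= X)%E -> _]add0e leeD2rE// ge0_fin_numE//.
  by apply: integral_ge0 => u _; rewrite EFinD adde_ge0.
have ae0 : {ae leb, forall u, gap u = 0}.
  have gap0' u : (0 <= (gap u)%:E)%E by rewrite lee_fin.
  have : {ae leb, forall u, (gap u)%:E = 0%E}.
    by apply: ge0_integral_eq0_ae; [exact: mgap|exact: gap0'|exact: gapI].
  by apply: ae_mono => u [].
have dL := dfun_mean_diff mu nu.
have Lae : {ae leb, forall u, forall z, mean_diff mu nu (gauss (expR u) z) = 0}.
  apply: ae_mono ae0 => u gu z.
  apply: gauss_null => //; first exact: expR_gt0.
  rewrite mean_diff_gauss ?expR_gt0//.
  have := expR_gt0 (- (beta / 2 * u)) => w0u.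
  apply: (mulIf (lt0r_neq0 w0u)); rewrite mul0r -[RHS]gu /gap /gauss_weight.
  by ring.
have Lgauss t z : 0 < t -> mean_diff mu nu (gauss t z) = 0.
  move=> t0.
  (* Points of the full-measure set decrease towards ln t within 1/(k+1), and dominated convergence
     carries the vanishing over to t itself. *)
  have /choice[u uP] k : exists u, (ln t < u < ln t + k.+1%:R^-1) /\
      forall z, mean_diff mu nu (gauss (expR u) z) = 0.
    have k0 : (0 : R) < k.+1%:R^-1 by rewrite invr_gt0.
    by have [u ? ?] := ae_dense (ln t) k0 Lae; exists u.
  have LE : mean_diff mu nu (gauss (expR (u k)) z) @[k --> \oo] -->
      mean_diff mu nu (gauss t z).
    apply: (dfun_cvg dL (M := 1)).
    - by move=> k; exact: (bounded_measurable_gaussr z (expR_ge0 (u k))).1.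
    - by move=> k x; rewrite ger0_norm ?gauss_ge0// gauss_le1 ?expR_ge0.
    - move=> x; apply: continuous_cvg; first exact: continuous_expR.
      apply: cvgMr_tmp; apply: cvgN; rewrite -[X in _ --> X](lnK t0).
      apply: continuous_cvg; first exact: continuous_expR.
      apply: (@squeeze_cvgr _ _ _ _ (fun=> ln t) (fun k => ln t + k.+1%:R^-1)).
      - by apply: nearW => k; have [/andP[/ltW-> /ltW->]] := uP k.
      - exact: cvg_cst.
      - rewrite -[X in _ --> X]addr0; apply: cvgD; first exact: cvg_cst.
        exact: cvg_harmonic.
  rewrite -(cvg_lim _ LE)//.
  by under eq_fun do rewrite (uP _).2; exact: lim_cst.
have := gauss_uniqueness dL Lgauss mA.
rewrite /mean_diff /Rintegral !integral_indic// !setIT => /eqP.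
rewrite mulN1r subr_eq0 => /eqP h.
rewrite -(@fineK _ (mu A)) ?h; last exact: fin_num_measure.
by rewrite fineK//; exact: fin_num_measure.
Qed.

End EnergyDistance.

(** * Conditional laws *)

Section Disintegration.
Context {R : realType} {dO dV dW : measure_display}.
Context {Omega : measurableType dO} {TV : measurableType dV}.
Context {TW : measurableType dW}.
Variables (V : Omega -> TV) (W : Omega -> TW).
Hypotheses (mV : measurable_fun [set: Omega] V).
Hypotheses (mW : measurable_fun [set: Omega] W).
Variable K : R.-pker TW ~> TV.
Local Open Scope ereal_scope.

(* The law of [(W w, v)] for [v] drawn from [K (W w)]. *)
Definition graph_kernel (p : unit * Omega) : {measure set (TW * TV) -> \bar R}.
Proof.
refine (pushforward (K (W p.2)) (pair (W p.2))).
exact: pair1_measurable.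
Defined.

Let measurable_graph_kernel U : measurable U ->
  measurable_fun [set: unit * Omega] (graph_kernel ^~ U).
Proof.
move=> mU.
have mk : measurable_fun [set: TW] (fun w => \int[K w]_v (\1_U (w, v))%:E).
  apply: (measurable_fun_integral_finite_kernel (fun z => (\1_U z)%:E) K).
    by move=> z; rewrite lee_fin.
  exact/measurable_EFinP/measurable_indic.
rewrite (_ : graph_kernel ^~ U =
    (fun w => \int[K w]_v (\1_U (w, v))%:E) \o (W \o snd)).
  by apply: (measurableT_comp mk); exact: measurableT_comp.
apply/funext => p /=.
rewrite (_ : (fun v => _) = EFin \o \1_((pair (W p.2)) @^-1` U)).
  rewrite integral_indic ?setIT//.
  by rewrite -[_ @^-1` _]setTI; exact: (pair1_measurable (W p.2)).
by apply/funext => v.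
Qed.

HB.instance Definition _ := isKernel.Build _ _ _ _ R graph_kernel
  measurable_graph_kernel.

Let graph_kernelT p : graph_kernel p [set: TW * TV] = 1.
Proof.
by rewrite /graph_kernel/= /pushforward preimage_setT prob_kernel.
Qed.

HB.instance Definition _ := Kernel_isProbability.Build _ _ _ _ R graph_kernel
  graph_kernelT.

Variable P : probability Omega R.
Hypothesis KP : conditional_law P V W K.

(** The defining property of a conditional law is the case of indicators of rectangles. It says that
    two laws on the product agree on a generating class stable under intersection, hence
    everywhere. *)
Theorem disintegration (f : TW * TV -> \bar R) :
  measurable_fun [set: TW * TV] f -> (forall z, 0 <= f z) ->
  \int[P]_w f (W w, V w) = \int[P]_w \int[K (W w)]_v f (W w, v).
Proof.
move=> mf f0.
(* [P] is viewed as a kernel from a one-point space, so that its composition with [graph_kernel] is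
   the law of the pair drawn through [K]. *)
pose cP := kprobability (measurable_cst (P : pprobability Omega R) :
  measurable_fun [set: unit] (fun=> (P : pprobability Omega R))).
have mWV : measurable_fun [set: Omega] (fun w => (W w, V w)).
  exact: measurable_fun_pair.
have := integral_kcomp cP graph_kernel tt f0 mf.
have inner w : \int[graph_kernel (tt, w)]_z f z = \int[K (W w)]_v f (W w, v).
  by rewrite (ge0_integral_pushforward (pair1_measurable (W w))).
under [X in _ = X -> _]eq_integral do rewrite inner.
move=> <-.
have -> : \int[P]_w f (W w, V w) =
    \int[pushforward P (fun w => (W w, V w))]_z f z.
  by rewrite (ge0_integral_pushforward mWV).
apply: eq_measure_integral => A mA _.
pose G := [set A1 `*` A2 | A1 in measurable & A2 in measurable] : set (set (TW
  * TV)).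
apply: (measure_unique G (fun=> setT)) => //.
- by rewrite measurable_prod_measurableType.
- move=> _ _ [A1 mA1 [A2 mA2 <-]] [B1 mB1 [B2 mB2 <-]].
  by rewrite -setXI; exists (A1 `&` B1); [exact: measurableI|
    exists (A2 `&` B2); [exact: measurableI|]].
- by exists setT => //; exists setT => //; rewrite setXTT.
- by rewrite bigcup_const//; exists 0%N.
- move=> _ [B mB [C mC <-]].
  transitivity (P (V @^-1` C `&` W @^-1` B)).
    by congr (P _); apply/seteqP; split => w /= [].
  rewrite KP// integral_mkcond; apply: eq_integral => w _.
  rewrite patchE /pushforward; case: ifPn => [|/negP]; rewrite inE/= => Bw.
    by congr (K (W w) _); apply/seteqP; split => v /= => [Cv|[]].
  apply/esym; rewrite -[RHS](measure0 (K (W w))); congr (K (W w) _).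
  by apply/seteqP; split => v //= [].
- move=> _; rewrite /= /pushforward preimage_setT probability_setT.
  exact: ltry.
Qed.

End Disintegration.

Section KernelLaw.
Context {R : realType} {d d' : measure_display}.
Context {TW : measurableType d} {TV : measurableType d'}.
Variable K : R.-pker TW ~> TV.

(** The measure [K z] under a name that carries the probability structure expected by [energy] and
    [moment]. *)
Definition kernel_law (z : TW) : set TV -> \bar R := K z.

HB.instance Definition _ z := Measure.on (kernel_law z).
HB.instance Definition _ z :=
  Measure_isProbability.Build _ _ _ (kernel_law z) (@prob_kernel _ _ _ _ _ K z).

End KernelLaw.

(** * Uniqueness of the Gaussian law and integrals over independent copies *)

Section GaussianLaw.
Context {R : realType} {d : measure_display} {Omega : measurableType d}.
Variable P : probability Omega R.
Local Open Scope ereal_scope.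

(** Boxes are needed because [standard_gaussian] fixes probabilities on them only and because,
    unlike the preimages under a single coordinate, they are stable under intersection. *)
Lemma tuple_measurable_boxes (m : nat) : @measurable _ (m.-tuple R) =
  <<s [set A | exists B : 'I_m -> set R, (forall i, measurable (B i)) /\
         A = [set x | forall i, B i (tnth x i)]] >>.
Proof.
apply/seteqP; split.
  apply: smallest_sub; first exact: smallest_sigma_algebra.
  rewrite -bigcup_seq => _ [i _ [D mD <-]].
  apply: sub_sigma_algebra; exists (fun j => if j == i then D else setT).
  split=> [j|]; first by case: ifP => _.
  apply/seteqP; split => [x [_ Dx] j|x /(_ i)]; first by case: eqP => // ->.
  by rewrite /= eqxx => Dx; split.
apply: smallest_sub; first exact: sigma_algebra_measurable.
move=> _ [B [mB ->]].
rewrite (_ : [set x | _] =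
    \big[setI/setT]_(i < m) ((fun x : m.-tuple R => tnth x i) @^-1` (B i))).
  apply: bigsetI_measurable => i _; rewrite -[_ @^-1` _]setTI.
  exact: (measurable_tnth i measurableT).
rewrite -bigcap_seq; apply/seteqP; split => x /= Bx i.
  by move=> _; exact: Bx.
by apply: (Bx i); rewrite /= mem_index_enum.
Qed.

Lemma standard_gaussian_unique (m : nat) (eps eps' : {RV P >-> m.-tuple R}) A :
  standard_gaussian P eps -> standard_gaussian P eps' -> measurable A ->
  P (eps @^-1` A) = P (eps' @^-1` A).
Proof.
move=> ge ge' mA.
have := @measure_unique _ _ _ _ (fun=> setT) (tuple_measurable_boxes m) _ _ _
  (distribution P eps) (distribution P eps') _ _ _ mA; apply.
- move=> _ _ [B [mB ->]] [B' [mB' ->]]; exists (fun i => B i `&` B' i); split.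
    by move=> i; exact: measurableI.
  apply/seteqP; split => [x [Bx B'x] i|x Bx]; first by split.
  by split => i; have [] := Bx i.
- move=> _; exists (fun=> setT); split => //.
  by apply/seteqP; split.
- by rewrite bigcup_const//; exists 0%N.
- move=> _ [B [mB ->]].
  transitivity (\prod_(i < m) normal_prob 0 1 (B i)); first exact: ge.
  by apply/esym; exact: ge'.
- by move=> _; rewrite [X in X < _](probability_setT (distribution P eps)) ltry.
Qed.

End GaussianLaw.

Section Independence.
Context {R : realType} {d dT : measure_display}.
Context {Omega : measurableType d} {T : measurableType dT}.
Variable P : probability Omega R.
Local Open Scope ereal_scope.

(** Independence says that the constant kernel at the common law is a conditional law of [U'] given
    [U], so this is a disintegration. *)
Lemma integral_iid (U U' : {RV P >-> T}) (f : T * T -> \bar R) :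
  (forall A B, measurable A -> measurable B ->
    P (U @^-1` A `&` U' @^-1` B) = P (U @^-1` A) * P (U' @^-1` B)) ->
  (forall A, measurable A -> P (U @^-1` A) = P (U' @^-1` A)) ->
  measurable_fun [set: T * T] f -> (forall z, 0 <= f z) ->
  \int[P]_w f (U w, U' w) =
  \int[distribution P U]_x \int[distribution P U]_y f (x, y).
Proof.
move=> ind same mf f0.
pose K := kprobability (measurable_cst (distribution P U : pprobability T R) :
  measurable_fun [set: T] (fun=> (distribution P U : pprobability T R))).
have KP : conditional_law P U' U K.
  move=> A B mA mB; rewrite setIC ind// -same//.
  rewrite [RHS](_ : _ = \int[P]_(w in U @^-1` B) cst (P (U @^-1` A)) w)//.
  rewrite integral_cst 1?muleC//.
  by rewrite -[_ @^-1` _]setTI; exact: measurable_funP.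
have mU : measurable_fun [set: Omega] U by [].
have mU' : measurable_fun [set: Omega] U' by [].
rewrite (disintegration mU' mU KP mf f0).
rewrite [RHS]ge0_integral_pushforward//=.
  apply: (measurable_fun_fubini_tonelli_F (m2 := distribution P U) f mf) => //.
by move=> x _; exact: integral_ge0.
Qed.

End Independence.

(** * Finite moments give finite energies *)

Section Moments.
Context {R : realType} {n : nat}.
Local Notation T := (n.-tuple R).
Variable beta : R.
Hypotheses (beta_gt0 : (0 < beta)%R) (beta_lt2 : (beta < 2)%R).
Local Open Scope ereal_scope.

Lemma euclid_norm_ge0 (x : T) : (0 <= euclid_norm x)%R.
Proof. exact: sqrtr_ge0. Qed.

Lemma measurable_euclid_norm_powR :
  measurable_fun [set: T] (fun x => (euclid_norm x `^ beta)%:E).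
Proof.
rewrite (_ : (fun x : T => _) =
    fun x : T => (euclid_dist x [tuple 0%R | i < n] `^ beta)%:E).
  exact: measurable_euclid_dist_powR.
apply/funext => x; congr ((euclid_norm _ `^ _)%:E).
by apply: eq_from_tnth => i; rewrite !tnth_mktuple subr0.
Qed.

(** The distance is at most twice the larger norm, 2^beta <= 2^2 = 4, and a maximum is at most the
    sum. Only finiteness matters later. *)
Lemma euclid_dist_powR_le (x y : T) : (euclid_dist x y `^ beta <=
  4 * (euclid_norm x `^ beta + euclid_norm y `^ beta))%R.
Proof.
pose M := Num.max (euclid_norm x) (euclid_norm y).
have M0 : (0 <= M)%R by rewrite le_max euclid_norm_ge0.
have xM : (euclid_norm x <= M)%R by rewrite le_max lexx.
have yM : (euclid_norm y <= M)%R by rewrite le_max lexx orbT.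
have dM : (euclid_dist x y <= 2 * M)%R.
  rewrite -(@ler_pXn2r _ 2)// ?nnegrE ?mulr_ge0 ?sqrtr_ge0//.
  rewrite euclid_dist_sqE; have := normr_dotp x y.
  have := ler_norm (- dotp x y); rewrite normrN -!euclid_normE => h1 h2.
  have := euclid_norm_ge0 x; have := euclid_norm_ge0 y; nra.
apply: (@le_trans _ _ ((2 * M) `^ beta)%R).
  by apply: ge0_ler_powR; rewrite ?nnegrE ?mulr_ge0 ?sqrtr_ge0// ltW.
rewrite powRM//; apply: ler_pM; rewrite ?powR_ge0//.
  apply: (@le_trans _ _ (2 `^ 2)%R).
    by apply: ler_powR; [rewrite lerDl|exact: ltW].
  by rewrite (powR_mulrn 2)// expr2; lra.
rewrite /M maxEle; case: ifP => _; rewrite ?lerDl ?lerDr powR_ge0//.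
Qed.

Definition moment (mu : probability T R) : \bar R :=
  \int[mu]_x (euclid_norm x `^ beta)%:E.

Let N0 (x : T) : 0 <= (euclid_norm x `^ beta)%:E.
Proof. by rewrite lee_fin powR_ge0. Qed.

Lemma moment_ge0 mu : 0 <= moment mu.
Proof. exact: integral_ge0. Qed.

Let integral_momentD (mu : probability T R) (a : \bar R) : 0 <= a ->
  \int[mu]_(x in [set: T]) (4%:E * ((euclid_norm x `^ beta)%:E + a)) =
    4%:E * (moment mu + a).
Proof.
move=> a0; have mN := measurable_euclid_norm_powR.
rewrite ge0_integralZl//; last 2 first.
- exact: emeasurable_funD.
- by move=> x _; rewrite adde_ge0.
congr (_ * _); rewrite ge0_integralD//; congr (_ + _).
by rewrite integral_cst//= probability_setT mule1.
Qed.

Lemma energy_moment (mu nu : probability T R) : energy beta mu nu <= 4%:E *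
  (moment mu + moment nu).
Proof.
have mN := measurable_euclid_norm_powR.
have d0 (z : T * T) : 0 <= (euclid_dist z.1 z.2 `^ beta)%:E.
  by rewrite lee_fin powR_ge0.
have mE : measurable_fun [set: T * T]
    (fun z : T * T => (euclid_dist z.1 z.2 `^ beta)%:E).
  exact: measurable_euclid_dist_powR.
rewrite -integral_momentD ?moment_ge0//; apply: ge0_le_integral => //.
- by move=> x _; apply: integral_ge0 => y _; exact: (d0 (x, y)).
- exact: (measurable_fun_fubini_tonelli_F _ mE d0).
- by apply: measurable_funeM; exact: emeasurable_funD.
move=> x _; rewrite addeC -integral_momentD//.
apply: ge0_le_integral => //.
- by move=> y _; exact: (d0 (x, y)).
- exact: measurable_euclid_dist_powR.
- by apply: measurable_funeM; exact: emeasurable_funD.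
- move=> y _; rewrite -EFinD -EFinM lee_fin addrC.
  exact: euclid_dist_powR_le.
Qed.

Lemma energy_lty (mu nu : probability T R) :
  moment mu < +oo -> moment nu < +oo -> energy beta mu nu < +oo.
Proof.
move=> mfin nfin; apply: (le_lt_trans (energy_moment mu nu)).
apply: lte_mul_pinfty => //; exact: lte_add_pinfty.
Qed.

End Moments.

(** * Comparison of integrals under almost sure inequalities *)

Section AlmostEverywhere.
Context {R : realType} {d : measure_display} {T : measurableType d}.
Variable mu : {measure set T -> \bar R}.
Local Open Scope ereal_scope.

Lemma ae_pushforward d' (T' : measurableType d') (phi : T -> T')
    (mphi : measurable_fun [set: T] phi) (nu : {measure set T' -> \bar R})
    (Q : T' -> Prop) : (forall A, nu A = mu (phi @^-1` A)) ->
  {ae nu, forall y, Q y} -> {ae mu, forall x, Q (phi x)}.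
Proof.
move=> nuE [N [mN N0 QN]]; exists (phi @^-1` N); split.
- by rewrite -[_ @^-1` _]setTI; exact: mphi.
- by rewrite -nuE.
- by move=> x Qx; exact: QN.
Qed.

Variables f g : T -> \bar R.
Hypotheses (mf : measurable_fun [set: T] f) (mg : measurable_fun [set: T] g).
Hypotheses (f0 : forall x, 0 <= f x) (fg : {ae mu, forall x, f x <= g x}).

Let mg' : measurable_fun [set: T] (fun x => maxe (g x) 0).
Proof. exact: measurable_maxe. Qed.

Let g'_ge0 x : 0 <= maxe (g x) 0.
Proof. by rewrite le_max lexx orbT. Qed.

Let fg' : {ae mu, forall x, f x <= maxe (g x) 0}.
Proof. by apply: ae_mono fg => x fgx; rewrite le_max fgx. Qed.

Let integral_g' : \int[mu]_x g x = \int[mu]_x maxe (g x) 0.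
Proof.
apply: ae_eq_integral => //; apply: ae_mono fg => x fgx _.
by rewrite (max_idPl (le_trans (f0 x) fgx)).
Qed.

(* [g] may be negative on a null set, so [ae_ge0_le_integral] does not apply. *)
Lemma ae_le_integral_ge0l : \int[mu]_x f x <= \int[mu]_x g x.
Proof.
rewrite integral_g'; apply: ae_ge0_le_integral => //.
by apply: ae_mono fg' => x fx _.
Qed.

(** Since the integral of [f] is finite, g - f can be integrated and has integral zero while being
    nonnegative almost everywhere. Truncating at 0 makes it nonnegative everywhere without changing
    the integral. *)
Lemma ae_eq_integral_ge0l : \int[mu]_x f x < +oo ->
  \int[mu]_x g x <= \int[mu]_x f x -> {ae mu, forall x, f x = g x}.
Proof.
move=> ffin gf.
have intf : mu.-integrable [set: T] f.
  apply/integrableP; split => //.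
  by under eq_integral do rewrite gee0_abs//.
have intg : mu.-integrable [set: T] (fun x => maxe (g x) 0).
  apply/integrableP; split => //.
  under eq_integral do rewrite gee0_abs//.
  by rewrite -integral_g'; exact: le_lt_trans ffin.
have ffinum := integrable_ae measurableT intf.
pose h := (fun x => maxe (g x) 0) \- f.
have mh : measurable_fun [set: T] h by exact: emeasurable_funB.
have hI : \int[mu]_x maxe (h x) 0 = 0.
  have <- : \int[mu]_x h x = \int[mu]_x maxe (h x) 0.
    apply: ae_eq_integral => //; first exact: measurable_maxe.
    near=> x => _; rewrite (max_idPl _)//.
    have fx : f x \is a fin_num by near: x; apply: ae_mono ffinum => x; apply.
    by rewrite /h/= sube_ge0 ?fx ?orbT//; near: x; exact: fg'.
  rewrite integralB// -integral_g'; apply/eqP; rewrite eq_le.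
  have fI : \int[mu]_x f x \is a fin_num by exact: integrable_fin_num.
  by rewrite sube_le0 gf sube_ge0 ?fI ?orbT// ae_le_integral_ge0l.
have := @ge0_integral_eq0_ae _ _ _ mu (fun x => maxe (h x) 0)
  (measurable_maxe mh (measurable_cst _)) _ hI.
have h0 x : 0 <= maxe (h x) 0 by rewrite le_max lexx orbT.
move=> /(_ h0) ae0.
near=> x.
have fx : f x \is a fin_num by near: x; apply: ae_mono ffinum => x; apply.
have fgx : f x <= g x by near: x; exact: fg.
have : maxe (h x) 0 = 0 by near: x; exact: ae0.
rewrite /h/= (max_idPl (le_trans (f0 x) fgx)) => hx.
apply/eqP; rewrite eq_le fgx /= -sube_le0 -hx le_max lexx//.
Unshelve. all: by end_near. Qed.

End AlmostEverywhere.

Section KernelFst.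
Context {R : realType} {d d' d'' : measure_display}.
Context {TW : measurableType d} {TV : measurableType d'} {TU : measurableType
  d''}.
Variable K : R.-pker TW ~> TV.

(** Used for double integrals against [K w]: the inner measure must be a kernel on the product
    carrying the outer integration variable as well. *)
Definition kernel_fst (p : TW * TU) : {measure set TV -> \bar R} := K p.1.

Let measurable_kernel_fst U : measurable U ->
  measurable_fun [set: TW * TU] (kernel_fst ^~ U).
Proof.
by move=> mU; apply: (measurableT_comp (measurable_kernel K U mU)).
Qed.

HB.instance Definition _ :=
  isKernel.Build _ _ _ _ R kernel_fst measurable_kernel_fst.

Let kernel_fst_prob p : kernel_fst p [set: TV] = 1%E.
Proof. exact: prob_kernel. Qed.

HB.instance Definition _ :=
  Kernel_isProbability.Build _ _ _ _ R kernel_fst kernel_fst_prob.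

End KernelFst.

Lemma measurable_kernel_double (R : realType) d d' (TW : measurableType d)
    (TV : measurableType d') (K : R.-pker TW ~> TV) (f : TV * TV -> \bar R) :
  (measurable_fun [set: TV * TV] f -> (forall z, 0 <= f z) ->
  measurable_fun [set: TW] (fun w => \int[K w]_x \int[K w]_y f (x, y)))%E.
Proof.
move=> mf f0.
apply: (measurable_fun_integral_finite_kernel
  (fun p : TW * TV => \int[K p.1]_y f (p.2, y))%E K).
  by move=> p; exact: integral_ge0.
apply: (measurable_fun_integral_finite_kernel
  (fun p : (TW * TV) * TV => f (p.1.2, p.2)) (kernel_fst (TU := TV) K)).
  by move=> p; exact: f0.
apply: (measurableT_comp mf (g := fun p : (TW * TV) * TV => (p.1.2, p.2))).
apply: measurable_fun_pair; last exact: measurable_snd.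
exact: (measurableT_comp measurable_snd measurable_fst).
Qed.

Section HalfIneq.
Context {R : realType}.
Implicit Types x y a : \bar R.
Local Open Scope ereal_scope.

(** In the application [x] and [y] are the self-energies of the conditional law and of the decoder
    law, and [a] is the energy between them. Only [y] is subtracted, so only [y] must be finite. *)
Lemma half_le x y a : y \is a fin_num -> 0 <= x -> 0 <= a ->
  x + y <= a + a -> (2^-1)%:E * x <= a - (2^-1)%:E * y.
Proof.
case: y => [y| |]// _; case: a => [a| |]//; case: x => [x| |]//.
- by rewrite -!EFinM -?EFinN -!EFinD !lee_fin => _ _; lra.
- by move=> _ _ _; rewrite -EFinM /= leey.
- by move=> _ _ _; rewrite -EFinM /= leey.
Qed.

(** The equality case, producing the two hypotheses of [energy_eq]. *)
Lemma half_ge x y a : y \is a fin_num -> x \is a fin_num -> 0 <= a ->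
  a - (2^-1)%:E * y = (2^-1)%:E * x -> a < +oo /\ a + a <= x + y.
Proof.
case: y => [y| |]// _; case: x => [x| |]// _; case: a => [a| |]//.
move=> _; rewrite -!EFinM -?EFinN -!EFinD => -[ax]; split; first exact: ltry.
by rewrite lee_fin; lra.
Qed.

End HalfIneq.

(** * The numerical loss *)

Section PairLeft.
Context {d d' : measure_display} {T : measurableType d} {T' : measurableType
  d'}.

(** A name that carries the measurable-function structure, so that [decoded] is a random variable by
    composition. *)
Definition pair_left (z : T) : T' -> T * T' := pair z.

HB.instance Definition _ z :=
  isMeasurableFun.Build _ _ _ _ (pair_left z) (@pair1_measurable _ _ T T' z).

End PairLeft.

Section NumericalPart.
Context {R : realType} {dnum l m dcat : nat} {C : 'I_dcat -> finPointedType}.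
Context {d : measure_display} {Omega : measurableType d}.
Variables (P : probability Omega R) (X : {RV P >-> input R dnum C}).
Variables (eps eps' : {RV P >-> m.-tuple R}) (beta : R).
Hypotheses (beta_gt0 : (0 < beta)%R) (beta_lt2 : (beta < 2)%R).
Hypotheses (eps_gaussian : standard_gaussian P eps)
  (eps'_gaussian : standard_gaussian P eps') (indep : independent3 P X eps
    eps').
Local Open Scope ereal_scope.
Local Notation T := (dnum.-tuple R).
Local Notation Z := (l.-tuple R).
Implicit Types (g : num_decoder R l m dnum) (z : Z).

Definition decoded (e : {RV P >-> m.-tuple R}) g z : {RV P >-> T} :=
  g \o (pair_left z \o e).

Definition decoder_law g z : probability T R :=
  distribution P (decoded eps g z).

Let dist_measurable : measurable_fun [set: T * T]
  (fun z : T * T => (euclid_dist z.1 z.2 `^ beta)%:E).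
Proof. exact: measurable_euclid_dist_powR. Qed.

Let dist_ge0 (z : T * T) : 0 <= (euclid_dist z.1 z.2 `^ beta)%:E.
Proof. by rewrite lee_fin powR_ge0. Qed.

Lemma eps_indep A B : measurable A -> measurable B ->
  P (eps @^-1` A `&` eps' @^-1` B) = P (eps @^-1` A) * P (eps' @^-1` B).
Proof.
move=> mA mB; have := indep measurableT mA mB.
by rewrite preimage_setT setTI probability_setT mul1e.
Qed.

Let decoded_preimage (e : {RV P >-> m.-tuple R}) g z A : measurable A ->
  exists2 B, measurable B & decoded e g z @^-1` A = e @^-1` B.
Proof.
move=> mA; exists ((g \o pair_left z) @^-1` A) => //.
by rewrite -[_ @^-1` _]setTI; exact: (measurable_funP (g \o pair_left z)).
Qed.

(** For fixed z the two decoded vectors are functions of independent noises with the same law, so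
    the second term is a double integral against [decoder_law]. *)
Lemma energy_scoreE (K : R.-pker Z ~> T) g z :
  energy_score eps eps' beta (K z) g z =
  energy beta (kernel_law K z) (decoder_law g z) -
  (2^-1)%:E * energy beta (decoder_law g z) (decoder_law g z).
Proof.
rewrite /energy_score; congr (_ - _ * _).
  apply: eq_integral => y _; rewrite [RHS]ge0_integral_pushforward//.
  - exact: measurable_euclid_dist_powR.
  - by move=> x _; exact: (dist_ge0 (y, x)).
rewrite (@integral_iid _ _ _ _ _ P (decoded eps g z) (decoded eps' g z)
  (fun z : T * T => (euclid_dist z.1 z.2 `^ beta)%:E))//.
- move=> A B mA mB.
  have [A' mA' ->] := decoded_preimage eps g z mA.
  have [B' mB' ->] := decoded_preimage eps' g z mB.
  exact: eps_indep.
- move=> A mA.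
  rewrite -[LHS]/(P (eps @^-1` ((g \o pair_left z) @^-1` A))).
  apply: (standard_gaussian_unique eps_gaussian eps'_gaussian).
  by rewrite -[_ @^-1` _]setTI; exact: (measurable_funP (g \o pair_left z)).
Qed.

Lemma measurable_energy_score (K : R.-pker Z ~> T) g :
  measurable_fun [set: Z] (fun z => energy_score eps eps' beta (K z) g z).
Proof.
have mdec (e : {RV P >-> m.-tuple R}) d' (U : measurableType d') (f : U -> Z)
    (h : U -> Omega) : measurable_fun [set: U] f -> measurable_fun [set: U] h ->
  measurable_fun [set: U] (fun u => g (f u, e (h u))).
  move=> mf mh; apply: (measurableT_comp (measurable_funP g)).
  by apply: measurable_fun_pair => //;
    exact: (measurableT_comp (measurable_funP e)).
apply: emeasurable_funB.
  apply: (measurable_fun_integral_finite_kernel (fun p : Z * T =>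
    \int[P]_w (euclid_dist p.2 (g (p.1, eps w)) `^ beta)%:E) K).
    by move=> p; apply: integral_ge0 => w _; rewrite lee_fin powR_ge0.
  apply: (measurable_fun_fubini_tonelli_F (m2 := P) (fun q : (Z * T) * Omega =>
    (euclid_dist q.1.2 (g (q.1.1, eps q.2)) `^ beta)%:E)).
    apply: measurable_euclid_dist_powR.
      exact: (measurableT_comp measurable_snd measurable_fst).
    apply: mdec; last exact: measurable_snd.
    exact: (measurableT_comp measurable_fst measurable_fst).
  by move=> q; rewrite lee_fin powR_ge0.
apply: measurable_funeM.
apply: (measurable_fun_fubini_tonelli_F (m2 := P) (fun q : Z * Omega =>
  (euclid_dist (g (q.1, eps q.2)) (g (q.1, eps' q.2)) `^ beta)%:E)).
  by apply: measurable_euclid_dist_powR; apply: mdec.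
by move=> q; rewrite lee_fin powR_ge0.
Qed.

Lemma moment_decoder_law g z : moment beta (decoder_law g z) =
  \int[P]_w (euclid_norm (g (z, eps w)) `^ beta)%:E.
Proof.
rewrite /moment ge0_integral_pushforward//.
- exact: measurable_euclid_norm_powR.
- by move=> x _; rewrite lee_fin powR_ge0.
Qed.

Section fixed_encoder.
Variables (e : encoder R dnum C l) (K : R.-pker Z ~> T) (g : num_decoder R l m
  dnum).
Hypothesis KP : conditional_law P (fun w => (X w).1) (fun w => e (X w)) K.
Hypothesis momentX : \int[P]_w (euclid_norm (X w).1 `^ beta)%:E < +oo.
Local Notation PZ := (distribution P (e \o X)).

Let disp z := (2^-1)%:E * energy beta (kernel_law K z) (kernel_law K z).

Let disp_ge0 z : 0 <= disp z.
Proof. by rewrite mule_ge0// ?energy_ge0// lee_fin invr_ge0. Qed.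

Let measurable_energy_kernel :
  measurable_fun [set: Z] (fun z => energy beta (kernel_law K z) (kernel_law K
    z)).
Proof. exact: (measurable_kernel_double K dist_measurable dist_ge0). Qed.

Let measurable_disp : measurable_fun [set: Z] disp.
Proof. exact: measurable_funeM. Qed.

Let meX : measurable_fun [set: Omega] (fun w => e (X w)).
Proof. exact: (measurable_funP (e \o X)). Qed.

Lemma integral_disp :
  \int[PZ]_z disp z = (2^-1)%:E * cond_dispersion X beta K e.
Proof.
rewrite ge0_integral_pushforward//= preimage_setT ge0_integralZl//.
- exact: (measurableT_comp measurable_energy_kernel meX).
- by move=> w _; exact: energy_ge0.
Qed.

Let measurable_moment_kernel :
  measurable_fun [set: Z] (fun z => moment beta (kernel_law K z)).
Proof.
apply: measurable_fun_integral_kernel.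
- by move=> U mU; exact: measurable_kernel.
- by move=> x; rewrite lee_fin powR_ge0.
- exact: measurable_euclid_norm_powR.
Qed.

Let integral_moment :
  \int[PZ]_z moment beta (kernel_law K z) < +oo.
Proof.
have mN : measurable_fun [set: T] (fun x : T => (euclid_norm x `^ beta)%:E).
  exact: measurable_euclid_norm_powR.
have mX1 : measurable_fun [set: Omega] (fun w => (X w).1).
  exact: (measurableT_comp measurable_fst).
have N0 (p : Z * T) : 0 <= (euclid_norm p.2 `^ beta)%:E.
  by rewrite lee_fin powR_ge0.
have mN2 : measurable_fun [set: Z * T] (fun p : Z * T => (euclid_norm p.2 `^
  beta)%:E).
  exact: (measurableT_comp mN measurable_snd).
rewrite ge0_integral_pushforward//= ?preimage_setT.
- by rewrite -(disintegration mX1 meX KP mN2 N0).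
- by move=> z _; exact: moment_ge0.
Qed.

Lemma ae_moment_kernel : {ae PZ, forall z, moment beta (kernel_law K z) < +oo}.
Proof.
have : PZ.-integrable [set: Z] (fun z => moment beta (kernel_law K z)).
  apply/integrableP; split => //.
  by under eq_integral do rewrite gee0_abs ?moment_ge0//.
move=> /(integrable_ae measurableT); apply: ae_mono => z /(_ Logic.I).
by rewrite ge0_fin_numE ?moment_ge0.
Qed.

Lemma cond_dispersion_lty : (2^-1)%:E * cond_dispersion X beta K e < +oo.
Proof.
rewrite -integral_disp.
apply: (@le_lt_trans _ _ (\int[PZ]_z (4%:E * moment beta (kernel_law K z)))).
  apply: ge0_le_integral => //.
  - exact: measurable_funeM.
  - move=> z _; apply: (@le_trans _ _ ((2^-1)%:E *
      (4%:E * (moment beta (kernel_law K z) + moment beta (kernel_law K z))))).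
      by rewrite lee_pmul2l// ?lte_fin ?invr_gt0// energy_moment.
    case: (moment _ _) (moment_ge0 beta (kernel_law K z)) => [r| |]// _.
    + by rewrite -EFinD -!EFinM lee_fin; lra.
    + by rewrite gt0_muley ?lte_fin// leey.
rewrite ge0_integralZl//; last by move=> z _; exact: moment_ge0.
apply: lte_mul_pinfty => //; exact: integral_moment.
Qed.

Hypothesis moment_g : {ae PZ, forall z,
  \int[P]_w (euclid_norm (g (z, eps w)) `^ beta)%:E < +oo}.

Let score_ge : {ae PZ, forall z,
  disp z <= energy_score eps eps' beta (K z) g z}.
Proof.
apply: ae_mono moment_g => z; rewrite -moment_decoder_law => mz.
rewrite energy_scoreE; apply: half_le; rewrite ?energy_ge0//.
  by rewrite ge0_fin_numE ?energy_ge0//; exact: energy_lty.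
exact: energy_le.
Qed.

Lemma loss_num_ge :
  (2^-1)%:E * cond_dispersion X beta K e <= loss_num X eps eps' beta K e g.
Proof.
rewrite -integral_disp; apply: ae_le_integral_ge0l => //.
exact: measurable_energy_score.
Qed.

(** The score dominates [disp] almost everywhere, and [disp] has a finite integral. Attaining the
    bound thus forces equality at almost every z, where strict propriety identifies the law. *)
Lemma loss_num_eq :
  loss_num X eps eps' beta K e g <= (2^-1)%:E * cond_dispersion X beta K e ->
  {ae PZ, forall z, has_law P (fun w => g (z, eps w)) (K z)}.
Proof.
rewrite -integral_disp => le.
have := ae_eq_integral_ge0l measurable_disp (measurable_energy_score K g)
  disp_ge0 score_ge _ le.
rewrite integral_disp => /(_ cond_dispersion_lty) eq.
near=> z.
have mK : moment beta (kernel_law K z) < +oo by near: z;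
  exact: ae_moment_kernel.
have mg : moment beta (decoder_law g z) < +oo.
  by rewrite moment_decoder_law; near: z; exact: moment_g.
have efin nu mu : moment beta nu < +oo -> moment beta mu < +oo ->
    energy beta nu mu \is a fin_num.
  by move=> fn fm; rewrite ge0_fin_numE ?energy_ge0//; exact: energy_lty.
have : disp z = energy_score eps eps' beta (K z) g z by near: z; exact: eq.
rewrite energy_scoreE => /esym/half_ge[];
  rewrite ?efin ?energy_ge0// => fin le2 A mA.
exact/esym/(energy_eq _ _ fin le2 mA).
Unshelve. all: by end_near. Qed.

Lemma loss_num_optimal :
  {ae PZ, forall z, has_law P (fun w => g (z, eps w)) (K z)} ->
  loss_num X eps eps' beta K e g = (2^-1)%:E * cond_dispersion X beta K e.
Proof.
move=> law; rewrite -integral_disp; apply: ae_eq_integral => //.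
  exact: measurable_energy_score.
near=> z => _; rewrite energy_scoreE.
have mK : moment beta (kernel_law K z) < +oo by near: z;
  exact: ae_moment_kernel.
have lawz : forall A, measurable A -> decoder_law g z A = kernel_law K z A.
  by near: z; exact: law.
have Efin : energy beta (kernel_law K z) (kernel_law K z) \is a fin_num.
  by rewrite ge0_fin_numE ?energy_ge0//; exact: energy_lty.
have inner x : \int[decoder_law g z]_y (euclid_dist x y `^ beta)%:E =
    \int[kernel_law K z]_y (euclid_dist x y `^ beta)%:E.
  by apply: eq_measure_integral => A mA _; exact: lawz.
have -> : energy beta (kernel_law K z) (decoder_law g z) =
    energy beta (kernel_law K z) (kernel_law K z).
  by apply: eq_integral => x _; exact: inner.
have -> : energy beta (decoder_law g z) (decoder_law g z) =
    energy beta (kernel_law K z) (kernel_law K z).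
  rewrite /energy; under eq_integral do rewrite inner.
  by apply: eq_measure_integral => A mA _; exact: lawz.
rewrite /disp -(fineK Efin) -!EFinM -?EFinN -!EFinD; congr EFin; lra.
Unshelve. all: by end_near. Qed.

End fixed_encoder.
End NumericalPart.

(** * The categorical losses *)

Section Gibbs.
Context {R : realType}.

(** Up to the factor p, this is 1 + ln(q/p) <= q/p, strict unless q = p. As [ln 0 = 0] here, the
    case q = 0 < p has to be excluded; for p = 0 the logarithms are multiplied by zero. *)
Lemma gibbs_term (p q : R) : 0 <= p -> 0 <= q -> (0 < p -> 0 < q) ->
  p - q <= p * ln p - p * ln q ?= iff (p == q).
Proof.
rewrite le_eqVlt => /predU1P[<- q0 _|p0 q0 /(_ p0) {}q0].
  apply/leifP; rewrite !mul0r subrr sub0r; case: ifPn => [/eqP <-|q0'].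
    by rewrite oppr0.
  by rewrite oppr_lt0 lt_neqAle q0'.
apply/leifP; case: ifPn => [/eqP ->|pq]; first by rewrite !subrr.
rewrite -mulrBr -subr_gt0.
have : 1 + ln (q / p) < q / p.
  rewrite -{2}[q / p](@lnK _) ?posrE ?divr_gt0//; apply: expR_gt1Dx.
  rewrite ln_eq0 ?divr_gt0//; apply: contra pq => /eqP qp.
  by rewrite eq_sym -[q](divfK (lt0r_neq0 p0)) qp mul1r.
rewrite ln_div ?posrE// -(ltr_pM2r p0) divfK ?gt_eqF//.
by lra.
Qed.

Variable C : finType.
Variables p q : C -> R.
Hypotheses (p0 : forall c, 0 <= p c) (q0 : forall c, 0 <= q c).
Hypotheses (p1 : \sum_c p c = 1) (q1 : \sum_c q c = 1).

Definition entropy : R := - \sum_c p c * ln (p c).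

(** Extended-valued, since [- lne 0 = +oo]. A category of probability 0 contributes nothing because
    [0 * +oo = 0]. *)
Definition cross_entropy : \bar R := (\sum_c (p c)%:E * - lne (q c)%:E)%E.

Let pmf_le1 (r : C -> R) c : (forall a, 0 <= r a) -> \sum_a r a = 1 -> r c <= 1.
Proof. by move=> r0 <-; rewrite (bigD1 c)//= lerDl sumr_ge0. Qed.

Lemma oppe_lne_ge0 (x : R) : x <= 1 -> (0 <= - lne x%:E)%E.
Proof.
by move=> x1; rewrite /lne; case: ifP => _//=; rewrite lee_fin oppr_ge0 ln_le0.
Qed.

Lemma entropy_ge0 : 0 <= entropy.
Proof.
rewrite oppr_ge0; apply: sumr_le0 => c _.
by rewrite mulr_ge0_le0// ln_le0// pmf_le1.
Qed.

(** [gibbs_term] with q = 1 gives -p ln p <= 1 - p <= 1. This crude bound is enough to make the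
    conditional entropy finite. *)
Lemma entropy_le : entropy <= #|C|%:R.
Proof.
rewrite /entropy -sumrN -sumr_const; apply: ler_sum => c _.
have := (gibbs_term (p0 c) ler01 (fun=> ltr01)).1; rewrite ln1 mulr0 subr0.
by have := p0 c; lra.
Qed.

Lemma cross_entropyE : (forall c, 0 < p c -> 0 < q c) ->
  cross_entropy = (- \sum_c p c * ln (q c))%:E.
Proof.
move=> pq; rewrite /cross_entropy -sumrN -sumEFin; apply: eq_bigr => c _.
have [pc|pc] := ltP 0 (p c).
  by rewrite /lne leNgt pq//= -EFinM mulrN.
have -> : p c = 0 by apply/eqP; rewrite eq_le pc p0.
by rewrite mul0e mul0r oppr0.
Qed.

Lemma cross_entropy_pinfty c : 0 < p c -> q c = 0 -> cross_entropy = +oo%E.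
Proof.
move=> pc qc; rewrite /cross_entropy (bigD1 c)//= qc lexx /=.
rewrite gt0_muley ?lte_fin// addye// gt_eqF// (@lt_le_trans _ _ 0%E) ?ltNy0//.
apply: sume_ge0 => a _; rewrite mule_ge0 ?lee_fin//.
by apply: oppe_lne_ge0; rewrite pmf_le1.
Qed.

Let dominated_dec : (forall c, 0 < p c ->
  0 < q c) \/ exists c, 0 < p c /\ q c = 0.
Proof.
have [/forallP h|] := boolP [forall c, (0 < p c) ==> (0 < q c)].
  by left => c pc; apply: (implyP (h c)).
rewrite negb_forall => /existsP[c]; rewrite negb_imply -leNgt => /andP[pc qc].
by right; exists c; split=> //; apply/eqP; rewrite eq_le qc q0.
Qed.

(** The lower bounds p c - q c of [gibbs_term] sum to zero, as both functions have total mass 1. *)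
Let gap_ge0 : (forall c, 0 < p c -> 0 < q c) ->
  0 <= - \sum_c p c * ln (q c) - entropy ?= iff [forall c, p c == q c].
Proof.
move=> pq; rewrite /entropy opprK addrC -sumrB.
have := leif_sum (fun c _ => gibbs_term (p0 c) (q0 c) (@pq c)).
move=> /(_ xpredT); have -> : \sum_c (p c - q c) = 0.
  by rewrite sumrB p1 q1 subrr.
by [].
Qed.

Lemma gibbs_le : (entropy%:E <= cross_entropy)%E.
Proof.
have [pq|[c [pc qc]]] := dominated_dec.
  by rewrite cross_entropyE// lee_fin -subr_ge0; exact: (gap_ge0 pq).1.
by rewrite (cross_entropy_pinfty pc qc) leey.
Qed.

Lemma gibbs_eq : cross_entropy = entropy%:E -> forall c, p c = q c.
Proof.
have [pq|[c [pc qc]]] := dominated_dec; last first.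
  by rewrite (cross_entropy_pinfty pc qc).
rewrite cross_entropyE// => -[pqE] c; have := (gap_ge0 pq).2.
by rewrite pqE subrr eqxx => /esym/forallP/(_ c)/eqP.
Qed.

End Gibbs.

Section CategoricalIntegral.
Context {R : realType} {dcat : nat} {C : 'I_dcat -> finPointedType}.
Local Open Scope ereal_scope.

Lemma integral_categories (mu : {measure set (categories C) -> \bar R})
    (f : categories C -> \bar R) : (forall c, 0 <= f c) ->
  \int[mu]_c f c = \sum_(c : categories C) mu [set c] * f c.
Proof.
move=> f0; transitivity (\int[mu]_c
    \sum_(a : categories C) f a * (\1_[set a] c)%:E).
  apply: eq_integral => c _; rewrite (bigD1 c)//= indicE mem_set// mule1.
  rewrite big1 ?adde0// => a ac; rewrite indicE memNset ?mule0//.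
  by move=> /= ca; rewrite ca eqxx in ac.
rewrite ge0_integral_sum//.
  apply: eq_bigr => a _; rewrite ge0_integralZl//.
  by rewrite integral_indic// setIT muleC.
by move=> a c _; rewrite mule_ge0// lee_fin.
Qed.

End CategoricalIntegral.

Section CategoricalPart.
Context {R : realType} {dnum dcat : nat} {C : 'I_dcat -> finPointedType}.
Context {d dW : measure_display} {Omega : measurableType d}.
Context {TW : measurableType dW}.
Variables (P : probability Omega R) (X : {RV P >-> input R dnum C}).
Variables (W : Omega -> TW) (K : R.-pker TW ~> categories C).
Hypothesis mW : measurable_fun [set: Omega] W.
Hypothesis KP : conditional_law P (fun w => (X w).2) W K.
Local Open Scope ereal_scope.
Implicit Types (q : cond_pmf R TW (categories C)) (z : TW).

Definition kernel_pmf z (c : categories C) : R := fine (K z [set c]).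

Lemma EFin_kernel_pmf z c : (kernel_pmf z c)%:E = K z [set c].
Proof. by rewrite fineK//; exact: finite_kernel_measure. Qed.

Lemma kernel_pmf_ge0 z c : (0 <= kernel_pmf z c)%R.
Proof. exact: fine_ge0. Qed.

Lemma kernel_pmf_sum1 z : (\sum_c kernel_pmf z c = 1)%R.
Proof.
apply: EFin_inj; rewrite -sumEFin.
under eq_bigr do rewrite EFin_kernel_pmf -[K z _]mule1.
rewrite -(integral_categories (K z) (f := fun=> 1))// integral_cst// mul1e.
exact: prob_kernel.
Qed.

Lemma measurable_kernel_pmf c : measurable_fun [set: TW] (kernel_pmf ^~ c).
Proof.
apply/measurable_EFinP.
rewrite (_ : EFin \o _ = K ^~ [set c]); first exact: measurable_kernel.
by apply/funext => z; exact: EFin_kernel_pmf.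
Qed.

Lemma measurable_oppe_lne : measurable_fun [set: R] (fun x : R => - lne x%:E).
Proof.
rewrite (_ : (fun x => _) =
  (fun x : R => if (x <= 0)%R then +oo else (- ln x)%:E)).
  apply: measurable_fun_ifT => //.
  - exact: measurable_fun_ler.
  - by apply/measurable_EFinP; apply: measurable_funN; exact: measurable_ln.
by apply/funext => x; rewrite /lne; case: ifP.
Qed.

Let oppe_lne_pmf_ge0 q z c : 0 <= - lne (q z c)%:E.
Proof.
apply: oppe_lne_ge0; rewrite -(pmf_sum1 q z) (bigD1 c)//= lerDl.
by apply: sumr_ge0 => a _; exact: Defs.pmf_ge0.
Qed.

Let measurable_oppe_lne_pmf q c : measurable_fun [set: TW] (fun z => - lne (q z
  c)%:E).
Proof.
have mq : measurable_fun [set: TW] (fun z => q z c).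
  exact: Defs.pmf_measurable.
exact: (measurableT_comp measurable_oppe_lne mq).
Qed.

Let cross q z := cross_entropy (kernel_pmf z) (q z).

Let cross_ge0 q z : 0 <= cross q z.
Proof.
by apply: sume_ge0 => c _; rewrite mule_ge0// lee_fin kernel_pmf_ge0.
Qed.

Let measurable_cross q : measurable_fun [set: TW] (cross q).
Proof.
apply: emeasurable_sum => c; apply: emeasurable_funM => //.
by apply/measurable_EFinP; exact: measurable_kernel_pmf.
Qed.

Let ent z := (entropy (kernel_pmf z))%:E.

Let ent_ge0 z : 0 <= ent z.
Proof.
by rewrite lee_fin; apply: entropy_ge0; [exact: kernel_pmf_ge0|
  exact: kernel_pmf_sum1].
Qed.

Let measurable_ent : measurable_fun [set: TW] ent.
Proof.
apply/measurable_EFinP; apply: measurable_funN; apply: measurable_sum => c.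
have mK := measurable_kernel_pmf c.
by apply: measurable_funM => //;
  exact: (measurableT_comp (@measurable_ln R) mK).
Qed.

Let ent_le_cross q z : ent z <= cross q z.
Proof.
by apply: gibbs_le; [exact: kernel_pmf_ge0|exact: Defs.pmf_ge0|
  exact: kernel_pmf_sum1|exact: pmf_sum1].
Qed.

Lemma log_lossE q : log_loss X W q = \int[P]_w cross q (W w).
Proof.
have mX2 : measurable_fun [set: Omega] (fun w => (X w).2).
  exact: (measurableT_comp measurable_snd).
have m : measurable_fun [set: TW * categories C] (fun p => - lne (q p.1
  p.2)%:E).
  (* Joint measurability in (z, c) follows from measurability in z for each of the finitely many
     categories. *)
  rewrite (_ : (fun p => _) = (fun p : TW * categories C =>
      \sum_(a : categories C) - lne (q p.1 a)%:E * (\1_[set a] p.2)%:E)).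
    apply: emeasurable_sum => a; apply: emeasurable_funM.
      exact: (measurableT_comp (measurable_oppe_lne_pmf q a) measurable_fst).
    have mi : measurable_fun [set: categories C] (fun c => (\1_[set a] c :
      R)%:E) by [].
    exact: (measurableT_comp mi measurable_snd).
  apply/funext => -[z c] /=; rewrite (bigD1 c)//= indicE mem_set// mule1.
  rewrite big1 ?adde0// => a ac; rewrite indicE memNset ?mule0//.
  by move=> /= ca; rewrite ca eqxx in ac.
rewrite /log_loss (disintegration mX2 mW KP m); last first.
  by move=> p; exact: oppe_lne_pmf_ge0.
apply: eq_integral => w _; rewrite integral_categories.
  by apply: eq_bigr => c _; rewrite EFin_kernel_pmf.
by move=> c; exact: oppe_lne_pmf_ge0.
Qed.

Let cond_entropyE : cond_entropy P W K = \int[P]_w ent (W w).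
Proof. by []. Qed.

Lemma cond_entropy_ge0 : 0 <= cond_entropy P W K.
Proof. by rewrite cond_entropyE; apply: integral_ge0. Qed.

Let measurable_entW : measurable_fun [set: Omega] (ent \o W).
Proof. exact: measurableT_comp. Qed.

Let measurable_crossW q : measurable_fun [set: Omega] (cross q \o W).
Proof. exact: measurableT_comp. Qed.

Lemma cond_entropy_fin_num : cond_entropy P W K \is a fin_num.
Proof.
rewrite ge0_fin_numE ?cond_entropy_ge0// cond_entropyE.
pose N : R := (#|{: categories C}|%:R)%R.
apply: (@le_lt_trans _ _ (\int[P]_w (cst N%:E w))).
  apply: ge0_le_integral => //=.
  move=> w _; rewrite lee_fin; apply: entropy_le.
  by move=> c; exact: kernel_pmf_ge0.
by rewrite integral_cst//= probability_setT mule1 ltry.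
Qed.

Lemma cond_entropy_le_log_loss q : cond_entropy P W K <= log_loss X W q.
Proof.
rewrite log_lossE cond_entropyE; apply: ge0_le_integral => //.
exact: measurable_crossW.
Qed.

Lemma log_loss_optimal q :
  {ae P, forall w, forall c, (q (W w) c)%:E = K (W w) [set c]} ->
  log_loss X W q = cond_entropy P W K.
Proof.
move=> qK; rewrite log_lossE cond_entropyE; apply: ae_eq_integral => //;
  first exact: measurable_crossW.
apply: ae_mono qK => w qKw _; have qE : q (W w) = kernel_pmf (W w) :> (_ -> _).
  by apply/funext => c; rewrite /kernel_pmf -qKw.
by rewrite /cross qE cross_entropyE//; exact: kernel_pmf_ge0.
Qed.

(** The measure [nu] is the law of [W], left generic so that [distribution P (e \o X)] can be
    supplied directly. *)
Lemma log_loss_eq q (nu : {measure set TW -> \bar R}) :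
  (forall A, nu A = P (W @^-1` A)) ->
  log_loss X W q <= cond_entropy P W K ->
  {ae nu, forall z, forall c, (q z c)%:E = K z [set c]}.
Proof.
move=> nuE.
have pushE (f : TW -> \bar R) : measurable_fun [set: TW] f ->
  (forall z, 0 <= f z) ->
    \int[nu]_z f z = \int[P]_w f (W w).
  move=> mf f0; transitivity (\int[pushforward P W]_z f z).
    by apply: eq_measure_integral => A _ _; exact: nuE.
  by rewrite (ge0_integral_pushforward mW).
have finE : \int[nu]_z ent z < +oo.
  rewrite pushE// -cond_entropyE -ge0_fin_numE ?cond_entropy_ge0//.
  exact: cond_entropy_fin_num.
rewrite log_lossE cond_entropyE -!pushE// => le.
have le0 : {ae nu, forall z, ent z <= cross q z}.
  by apply: aeW => z; exact: ent_le_cross.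
have := ae_eq_integral_ge0l measurable_ent (measurable_cross q) ent_ge0 le0
  finE le.
apply: ae_mono => z eqz c; rewrite -EFin_kernel_pmf; congr EFin; apply/esym.
by apply: (gibbs_eq _ _ _ _ (esym eqz));
  [exact: kernel_pmf_ge0|exact: Defs.pmf_ge0|
  exact: kernel_pmf_sum1|exact: pmf_sum1].
Qed.

Lemma ereal_inf_log_loss (I : Type) (q : I -> cond_pmf R TW (categories C)) :
  (exists i, {ae P, forall w, forall c,
    (q i (W w) c)%:E = K (W w) [set c]}) ->
  ereal_inf [set log_loss X W (q i) | i in [set: I]] = cond_entropy P W K.
Proof.
move=> [i qi]; apply/eqP; rewrite eq_le; apply/andP; split.
  by apply: ereal_inf_lbound; exists i => //; exact: log_loss_optimal.
by apply: le_ereal_inf_tmp => _ [j _ <-]; exact: cond_entropy_le_log_loss.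
Qed.

End CategoricalPart.

(** * Optimal decoders and encoders *)

Local Open Scope ereal_scope.

Theorem theorem1
  (R : realType) (dnum dcat l m : nat) (C : 'I_dcat -> finPointedType)
  (beta : R) (beta_gt0 : (0 < beta)%R) (beta_lt2 : (beta < 2)%R)
  (* the data and the noise *)
  (d : measure_display) (Omega : measurableType d) (P : probability Omega R)
  (X : {RV P >-> input R dnum C}) (eps eps' : {RV P >-> m.-tuple R})
  (eps_gaussian : standard_gaussian P eps)
  (eps'_gaussian : standard_gaussian P eps')
  (indep : independent3 P X eps eps')
  (* the admissible decoders and the auxiliary models *)
  (Dnum : set (num_decoder R l m dnum)) (Dcat : set (cat_decoder R l C))
  (Theta Psi : Type)
  (qtheta : Theta -> cond_pmf R (l.-tuple R) (categories C))
  (qpsi : Psi -> cond_pmf R (l.-tuple R * dnum.-tuple R)%type (categories C))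
  (* for every encoder e, the conditional laws of X^num given e(X), of X^cat
     given e(X), and of X^cat given (e(X), X^num) *)
  (Knum : encoder R dnum C l -> R.-pker (l.-tuple R) ~> (dnum.-tuple R))
  (Kcat : encoder R dnum C l -> R.-pker (l.-tuple R) ~> categories C)
  (Kcat' : encoder R dnum C l ->
    R.-pker (l.-tuple R * dnum.-tuple R) ~> categories C)
  (KnumP : forall e : encoder R dnum C l, conditional_law P (fun w => (X w).1)
    (fun w => e (X w)) (Knum e))
  (KcatP : forall e : encoder R dnum C l, conditional_law P (fun w => (X w).2)
    (fun w => e (X w)) (Kcat e))
  (Kcat'P : forall e : encoder R dnum C l, conditional_law P (fun w => (X w).2)
    (fun w => (e (X w), (X w).1)) (Kcat' e))
  (A1 : forall e : encoder R dnum C l, exists g h,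
    [/\ Dnum g, Dcat h &
      {ae distribution P (e \o X), forall z,
        has_law P (fun w => g (z, eps w)) (Knum e z) /\
        forall c, (h z c)%:E = Kcat e z [set c]}])
  (A2 : forall e : encoder R dnum C l,
    (exists theta, {ae P, forall w, forall c,
      (qtheta theta (e (X w)) c)%:E = Kcat e (e (X w)) [set c]}) /\
    (exists psi, {ae P, forall w, forall c,
      (qpsi psi (e (X w), (X w).1) c)%:E =
        Kcat' e (e (X w), (X w).1) [set c]}))
  (A3X : \int[P]_w (euclid_norm (X w).1 `^ beta)%:E < +oo)
  (A3D : forall (e : encoder R dnum C l) g, Dnum g ->
    {ae distribution P (e \o X), forall z,
      \int[P]_w (euclid_norm (g (z, eps w)) `^ beta)%:E < +oo})
  (lnum lcat lcind : R)
  (lnum_gt0 : (0 < lnum)%R) (lcat_gt0 : (0 < lcat)%R)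
  (lcind_gt0 : (0 < lcind)%R) (lsum1 : (lnum + lcat + lcind = 1)%R)
  (e0 : encoder R dnum C l) (g0 : num_decoder R l m dnum)
  (h0 : cat_decoder R l C)
  (g0_adm : Dnum g0) (h0_adm : Dcat h0) :
  let loss_total (e : encoder R dnum C l) g h :=
    lnum%:E * loss_num X eps eps' beta (Knum e) e g
    + lcat%:E * loss_cat X e h
    + lcind%:E * loss_cind X qtheta qpsi e in
  let objective (e : encoder R dnum C l) :=
    lnum%:E * ((2^-1)%:E * cond_dispersion X beta (Knum e) e)
    + lcat%:E * cond_entropy P (fun w => e (X w)) (Kcat e)
    + lcind%:E * cond_mutual_info X (Kcat e) (Kcat' e) e in
  (forall e g h, Dnum g -> Dcat h ->
    loss_total e0 g0 h0 <= loss_total e g h) ->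
  {ae distribution P X, forall x,
    has_law P (fun w => g0 (e0 x, eps w)) (Knum e0 (e0 x)) /\
    forall c, (h0 (e0 x) c)%:E = Kcat e0 (e0 x) [set c]} /\
  (forall e, objective e0 <= objective e).
Proof.
move=> loss_total objective opt.
have meX (e : encoder R dnum C l) : measurable_fun [set: Omega] (fun w => e (X
  w)).
  exact: (measurable_funP (e \o X)).
have meXX (e : encoder R dnum C l) :
    measurable_fun [set: Omega] (fun w => (e (X w), (X w).1)).
  by apply: measurable_fun_pair => //; exact: (measurableT_comp measurable_fst).
have cindE e : loss_cind X qtheta qpsi e =
  cond_mutual_info X (Kcat e) (Kcat' e) e.
  rewrite /loss_cind (ereal_inf_log_loss (meX e) (KcatP e) (A2 e).1).
  by rewrite (ereal_inf_log_loss (meXX e) (Kcat'P e) (A2 e).2).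
have cind_fin e : cond_mutual_info X (Kcat e) (Kcat' e) e \is a fin_num.
  by rewrite fin_numB (cond_entropy_fin_num P (Kcat e) (meX e))
    (cond_entropy_fin_num P (Kcat' e) (meXX e)).
have num_ge e g (Dg : Dnum g) := loss_num_ge beta_gt0 beta_lt2 eps_gaussian
  eps'_gaussian indep (Knum e) (A3D e g Dg).
have cat_ge e h := cond_entropy_le_log_loss (meX e) (KcatP e) h.
have disp_fin e : (2^-1)%:E * cond_dispersion X beta (Knum e) e \is a fin_num.
  rewrite ge0_fin_numE;
    first exact: (cond_dispersion_lty beta_gt0 beta_lt2 (KnumP e) A3X).
  rewrite mule_ge0// ?lee_fin ?invr_ge0//.
  by do 3 apply: integral_ge0 => ? _; rewrite lee_fin powR_ge0.
have ent_fin e := cond_entropy_fin_num P (Kcat e) (meX e).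
have objective_le e g h : Dnum g -> objective e <= loss_total e g h.
  move=> Dg; rewrite /objective /loss_total cindE leeD2r ?leeD//.
  - by rewrite lee_pmul2l ?lte_fin//; exact: num_ge.
  - by rewrite lee_pmul2l ?lte_fin//; exact: cat_ge.
have total_opt e : exists g h, [/\ Dnum g,
  Dcat h & loss_total e g h = objective e].
  have [g [h [Dg Dh gh]]] := A1 e; exists g, h; split => //.
  rewrite /objective /loss_total cindE; congr (_ * _ + _ * _ + _).
    apply: (loss_num_optimal beta_gt0 beta_lt2 eps_gaussian eps'_gaussian indep
      (KnumP e) A3X).
    by apply: ae_mono gh => z [].
  apply: (log_loss_optimal (meX e) (KcatP e)).
  have : {ae distribution P (e \o X), forall z, forall c,
    (h z c)%:E = Kcat e z [set c]}.
    by apply: ae_mono gh => z [].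
  by move/(ae_pushforward (meX e)); apply.
have total_le e : loss_total e0 g0 h0 <= objective e.
  have [g [h [Dg Dh <-]]] := total_opt e; exact: opt.
split; last by move=> e;
  exact: le_trans (objective_le _ _ h0 g0_adm) (total_le e).
(* An infinite loss would make the total infinite, against the finite objective. In real numbers the
   two excesses over the bounds are nonnegative, and their combination with positive weights is at
   most 0, so each of them vanishes. *)
have [num_le cat_le] : loss_num X eps eps' beta (Knum e0) e0 g0 <=
    (2^-1)%:E * cond_dispersion X beta (Knum e0) e0 /\
    loss_cat X e0 h0 <= cond_entropy P (fun w => e0 (X w)) (Kcat e0).
  have := total_le e0; rewrite /objective /loss_total cindE.
  move: (num_ge e0 g0 g0_adm) (cat_ge e0 h0) (disp_fin e0) (ent_fin e0)
    (cind_fin e0).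
  rewrite -/(loss_cat X e0 h0).
  case: (_ * cond_dispersion _ _ _ _) => [a| |]//.
  case: (cond_entropy _ _ _) => [b| |]//.
  case: (cond_mutual_info _ _ _ _) => [c| |]//.
  case: (loss_num _ _ _ _ _ _ _) => [x| |]//;
    case: (loss_cat _ _ _) => [y| |]//;
    rewrite ?gt0_muley ?lte_fin// -?EFinM ?addye ?addey// -?EFinD ?lee_fin//.
  move=> ax by_ _ _ _ le.
  have h1 : (0 <= lnum * (x - a))%R by rewrite mulr_ge0 ?subr_ge0// ltW.
  have h2 : (0 <= lcat * (y - b))%R by rewrite mulr_ge0 ?subr_ge0// ltW.
  split; rewrite -subr_le0.
    by rewrite -(pmulr_rle0 _ lnum_gt0); lra.
  by rewrite -(pmulr_rle0 _ lcat_gt0); lra.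
have := loss_num_eq beta_gt0 beta_lt2 eps_gaussian eps'_gaussian indep (KnumP
  e0)
  A3X (A3D e0 g0 g0_adm) num_le.
have := log_loss_eq (meX e0) (KcatP e0) (nu :=
  distribution P (e0 \o X)) _ cat_le.
move=> /(_ (fun=> erefl)) catE numE.
have both : {ae distribution P (e0 \o X), forall z,
    has_law P (fun w => g0 (z, eps w)) (Knum e0 z) /\
    forall c, (h0 z c)%:E = Kcat e0 z [set c]}.
  by near=> z; split; near: z; [exact: numE|exact: catE].
have me0 : measurable_fun [set: input R dnum C] e0 by exact: measurable_funP.
(* The exceptional set of latent points is null for the law of e0(X), so its preimage under [e0] is
   null for the law of X. *)
by move: both => /(ae_pushforward me0 (mu := distribution P X)); apply.
Unshelve. all: by end_near. Qed.
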